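(* A $4$-dimensional Bach-flat $pp$-wave $$g_4=2\,\mathrm{d}u\Big(\mathrm{d}r+\left(\bar z\alpha+z\bar\alpha\right)\mathrm{d}u\Big)+2\,\mathrm{d}z\,\mathrm{d}\bar z,$$ where $\alpha=\alpha(z,u)$ is a function of a complex variable $z$ and a real variable $u$ which is holomorphic in $z$, is conformally equivalent to a metric with vanishing Cotton tensor. Moreover, the following three properties are equivalent: (1) $\partial_z^2\alpha\equiv0$; (2) $g_4$ is conformally flat; (3) $g_4$ is conformally Einstein. In particular, any such metric with $\partial_z^2\alpha\not\equiv0$ is not conformally Einstein.
   Context: The real coordinates are $(x^1,x^2,u,r)$, with $z=\frac{x^1+\mathrm{i}x^2}{\sqrt2}$ and $\bar z=\frac{x^1-\mathrm{i}x^2}{\sqrt2}$, so that $2\,\mathrm dz\,\mathrm d\bar z=(\mathrm dx^1)^2+(\mathrm dx^2)^2$. The metrics $g_4$ are the case $\beta\equiv0$ of the general $4$-dimensional Bach-flat $pp$-wave $2\,\mathrm{d}u\big(\mathrm{d}r+(\bar z\alpha+z\bar\alpha+\beta+\bar\beta)\mathrm{d}u\big)+2\,\mathrm{d}z\,\mathrm{d}\bar z$ with $\alpha=\alpha(z,u)$ and $\beta=\beta(z,u)$ holomorphic in $z$. Two metrics $g,\hat g$ are conformally equivalent if $\hat g=e^{2\Upsilon}g$ for a function $\Upsilon$; $g$ is conformally flat, respectively conformally Einstein, if it is conformally equivalent to a flat, respectively Einstein, metric. The Cotton tensor is $C_{abc}=\nabla_c\mathsf P_{ab}-\nabla_b\mathsf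 P_{ac}$, where in dimension $n$ the Schouten tensor is $\mathsf P=\frac1{n-2}\big(\mathrm{Ric}-\frac{\mathrm{scal}}{2(n-1)}g\big)$. Bach-flat means that the Bach tensor $B_{ab}=\nabla_cC_{ab}{}^c-\mathsf P_{cd}W^c{}_{ab}{}^d$ vanishes, $W$ being the Weyl tensor.
   Formalization: Conformal equivalence to a metric with vanishing Cotton tensor is proved where z≠0 (across z=0 it fails, e.g. α=z²); ''conformally flat'' and ''conformally Einstein'' are read locally, near each point, since globally (1)⇒(2) fails (e.g. α=−z/2 on C×R). *)

(* Defs.v *)
(* MathComp-Analysis, over an arbitrary [R : realType]; complex numbers are
   [R[i]] from mathcomp-real-closed. *)
From HB Require Import structures.
From mathcomp Require Import all_boot all_order all_algebra.
From mathcomp Require Import all_classical all_reals all_analysis.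
From mathcomp Require Import complex.

Set Implicit Arguments.
Unset Strict Implicit.
Unset Printing Implicit Defensive.

Import Order.TTheory GRing.Theory Num.Theory.
Import numFieldNormedType.Exports.

Local Open Scope classical_set_scope.
Local Open Scope ring_scope.

Section Calculus.
Context {R : realType} {n : nat}.
Implicit Types (V : set 'rV[R]_n) (f : 'rV[R]_n -> R).

Definition pd (i : 'I_n) f (p : 'rV[R]_n) : R := 'D_(delta_mx 0 i) f p.

Fixpoint Ck (k : nat) V f : Prop :=
  (forall p, V p -> {for p, continuous f}) /\
  (if k is k'.+1 then
     forall i, (forall p, V p -> derivable f p (delta_mx 0 i)) /\
               Ck k' V (pd i f)
   else True).

Definition smooth V f : Prop := forall k, Ck k V f.

End Calculus.

(* A metric of any signature, in one coordinate chart, is the matrix [g p] of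
   its components at [p]; only its values on the open set at hand matter, and
   it is meant to be symmetric, invertible and smooth there. *)
Section Curvature.
Context {R : realType} {n : nat}.
Variable g : 'rV[R]_n -> 'M[R]_n.
Implicit Types (p : 'rV[R]_n) (a b c d i j k l m : 'I_n).

Definition ginv p i j : R := invmx (g p) i j.

(* Gamma^k_{ij} *)
Definition christoffel k i j p : R :=
  2^-1 * \sum_l ginv p k l * (pd i (fun q => g q j l) p
                              + pd j (fun q => g q i l) p
                              - pd l (fun q => g q i j) p).

(* R^l_{kij}, with the sign for which Ric_{kj} = R^i_{kij} is positive on round
   spheres *)
Definition riemann l k i j p : R :=
  pd i (christoffel l j k) p - pd j (christoffel l i k) p
  + \sum_m (christoffel l i m p * christoffel m j k p
            - christoffel l j m p * christoffel m i k p).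

Definition ricci k j p : R := \sum_i riemann i k i j p.

Definition scal p : R := \sum_i \sum_j ginv p i j * ricci i j p.

Definition schouten a b p : R :=
  (n%:R - 2)^-1 * (ricci a b p - scal p / (2 * (n%:R - 1)) * g p a b).

(* (nabla_c T)_{ab} for a covariant 2-tensor T *)
Definition nabla2 (T : 'I_n -> 'I_n -> 'rV[R]_n -> R) c a b p : R :=
  pd c (T a b) p
  - \sum_d (christoffel d c a p * T d b p + christoffel d c b p * T a d p).

Definition cotton a b c p : R :=
  nabla2 schouten c a b p - nabla2 schouten b a c p.

Definition flat_on (V : set 'rV[R]_n) : Prop :=
  forall p, V p -> forall l k i j, riemann l k i j p = 0.

Definition einstein_on (V : set 'rV[R]_n) : Prop :=
  exists lambda : R, forall p, V p -> forall i j,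
    ricci i j p = lambda * g p i j.

Definition cotton_flat_on (V : set 'rV[R]_n) : Prop :=
  forall p, V p -> forall a b c, cotton a b c p = 0.

End Curvature.

Section Conformal.
Context {R : realType} {n : nat}.
Implicit Types (g : 'rV[R]_n -> 'M[R]_n) (U V : set 'rV[R]_n).

Definition rescale (Y : 'rV[R]_n -> R) g (p : 'rV[R]_n) : 'M[R]_n :=
  expR (2 * Y p) *: g p.

(* [g] is conformally equivalent on all of [V] to a metric with property [P] *)
Definition conformally_on
    (P : ('rV[R]_n -> 'M[R]_n) -> set 'rV[R]_n -> Prop) V g : Prop :=
  exists Y, smooth V Y /\ P (rescale Y g) V.

(* The same, on a neighbourhood of every point of [U].  For plane waves with
   d_z^2 alpha = 0 a conformal factor making the metric flat (or Einstein)
   need not exist globally: for alpha = - z / 2 on all of C x R it would have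
   to be s(u)^-2 with s'' = - s, and every such s has zeros. *)
Definition locally_conformally
    (P : ('rV[R]_n -> 'M[R]_n) -> set 'rV[R]_n -> Prop) U g : Prop :=
  forall p, U p -> exists V, [/\ open V, V p, V `<=` U & conformally_on P V g].

Definition conformally_flat U g : Prop :=
  locally_conformally flat_on U g.

Definition conformally_einstein U g : Prop :=
  locally_conformally einstein_on U g.

End Conformal.

Section PPWave.
Context {R : realType}.
Local Notation C := R[i].

(* The coordinates (x^1, x^2, u, r) are numbered 0, 1, 2, 3. *)
Definition zc (p : 'rV[R]_4) : C :=
  Complex (p 0 0 / Num.sqrt 2) (p 0 1 / Num.sqrt 2).
Definition uc (p : 'rV[R]_4) : R := p 0 2.

Definition dcoord (i : 'I_4) : 'rV[R]_4 := delta_mx 0 i.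

(* symmetric product of covectors; v w = (v (x) w + w (x) v) / 2 *)
Definition symprod (v w : 'rV[R]_4) : 'M[R]_4 :=
  2^-1 *: (v^T *m w + w^T *m v).

Variables (Omega : set (C * R)) (alpha : C -> R -> C).

Definition chart : set 'rV[R]_4 := [set p | Omega (zc p, uc p)].

(* A conformal factor killing the Cotton tensor cannot extend across z = 0 in
   general: for alpha = z^2 the Weyl tensor vanishes there while the Cotton
   tensor does not, and the latter is then unaffected by rescaling. *)
Definition chart_z_neq0 : set 'rV[R]_4 := [set p | chart p /\ zc p <> 0].

(* \bar z alpha + z \bar alpha, a real number *)
Definition profile (p : 'rV[R]_4) : R :=
  complex.Re ((zc p)^* * alpha (zc p) (uc p)
              + zc p * (alpha (zc p) (uc p))^*).

(* 2 dz d\bar z = (dx^1)^2 + (dx^2)^2 *)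
Definition g4 (p : 'rV[R]_4) : 'M[R]_4 :=
  2 *: symprod (dcoord 2) (dcoord 3 + profile p *: dcoord 2)
  + symprod (dcoord 0) (dcoord 0) + symprod (dcoord 1) (dcoord 1).

Definition smooth_alpha : Prop :=
  smooth chart (fun p => complex.Re (alpha (zc p) (uc p))) /\
  smooth chart (fun p => complex.Im (alpha (zc p) (uc p))).

Definition holomorphic_in_z : Prop :=
  forall (z : C) (u : R), Omega (z, u) ->
    derivable (fun w : C^o => alpha w u : C^o) z 1.

Definition dz2 (z : C) (u : R) : C :=
  derive1n 2 (fun w : C^o => alpha w u : C^o) z.

End PPWave.

(* Main.v *)
Require Import Defs.
From HB Require Import structures.
From mathcomp Require Import all_boot all_order all_algebra.
From mathcomp Require Import all_classical all_reals all_analysis.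
From mathcomp Require Import complex.
From mathcomp Require Import ring lra.
Import Order.TTheory GRing.Theory Num.Theory.
Import numFieldNormedType.Exports.
Local Open Scope classical_set_scope.
Local Open Scope ring_scope.

Set Implicit Arguments.
Unset Strict Implicit.

(** Why the theorem holds.

    Write H for the profile, so that g = 2 du dr + 2 H du^2 + dx1^2 + dx2^2
    with H independent of r, and write L for the Laplacian of H in (x1, x2).
    As z = (x1 + i x2) / sqrt 2, the form H = conj(z) alpha + z conj(alpha)
    with alpha holomorphic gives H_zz = conj(z) alpha'' and
    (L / 2)_z = alpha''.  The geometry only needs the real and imaginary parts
    of conj(z) (L / 2)_z = H_zz, a pair of linear PDEs for H
    ([profile_pde_re], [profile_pde_im]), together with the fact that
    alpha'' = 0 exactly where dL vanishes ([dz2_eq0]).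

    Curvature.  For an arbitrary conformal factor exp(2 Y) the Christoffel
    symbols of exp(2 Y) g are polynomials in the jets of H and Y
    ([christoffelE]), hence so are the Riemann, Ricci and Schouten tensors.
    With E = dY (x) dY - Hess Y - (L / 2) du^2, the Ricci tensor is
    2 E - (box Y + 2 |dY|^2) g and the Schouten tensor is E - |dY|^2 g / 2
    ([ricciE], [schoutenE]).

    Cotton-flat rescaling.  For Y = - ln (x1^2 + x2^2) the Schouten tensor has
    only du dr and du^2 components, and the Cotton tensor is a combination of
    the two PDEs ([cotton_radial_rescaling]).

    alpha'' = 0 implies conformally flat.  Then H_x1x1 = H_x2x2 and
    H_x1x2 = 0, and locally H_x1x1 depends on u only.  A positive solution s(u)
    of s'' = H_x1x1 s exists near every u by Picard iteration ([linear_ode]),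
    and Y = - ln s annihilates the whole Riemann tensor ([flat_rescaling],
    [locally_flat]).

    Conformally flat implies conformally Einstein, trivially.

    Conformally Einstein implies alpha'' = 0.  Put sigma = exp(- Y).  The
    Einstein condition says that Hess sigma - (L / 2) sigma du^2 is a multiple
    of g ([einstein_hess]).  Suppose dL <> 0 and z <> 0 on an open set.
    Comparing third derivatives of sigma forces sigma_r = 0 ([sigma_r]), whence
    sigma is affine in (x1, x2) ([sigma_affine]).  Differentiating the du^2
    component once more and using the PDEs gives
    x1 sigma_x1 + x2 sigma_x2 = 2 sigma; an affine function homogeneous of
    degree two is zero, contradicting sigma > 0 ([einstein_contradiction]).

    Two facts of analysis link this to the hypotheses: mixed partial
    derivatives commute ([partial_comm]), and a C^1 pair satisfying the
    Cauchy-Riemann equations is complex differentiable ([derive1_CR]), which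
    turns the complex second derivative of alpha into real partial
    derivatives ([dz2_alpha]). *)

(** * Directional derivatives of real functions *)

Section DirectionalDerivatives.
Context {R : realType} {V : normedModType R}.
Implicit Types (f g : V -> R) (p v : V).

(** The [isd_] lemmas are the rules of differentiation for functions written
    as lambda-terms; composed as proof terms they yield the derivative of an
    explicit formula in one step. *)
Lemma isd_cst p v (c : R) : is_derive p v (fun=> c) 0.
Proof. exact: is_derive_cst. Qed.

Lemma isd_add p v f g a b : is_derive p v f a -> is_derive p v g b ->
  is_derive p v (fun q => f q + g q) (a + b).
Proof. by move=> fa gb; exact: is_deriveD. Qed.

Lemma isd_opp p v f a : is_derive p v f a -> is_derive p v (fun q => - f q) (- a).
Proof. by move=> fa; exact: is_deriveN. Qed.

Lemma isd_mul p v f g a b : is_derive p v f a -> is_derive p v g b ->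
  is_derive p v (fun q => f q * g q) (a * g p + f p * b).
Proof.
move=> fa gb; have := is_deriveM fa gb; rewrite /GRing.scale /= addrC.
by rewrite [g p * a]mulrC.
Qed.

Lemma isd_inv p v f a : f p != 0 -> is_derive p v f a ->
  is_derive p v (fun q => (f q)^-1) (- a * (f p)^-1 * (f p)^-1).
Proof.
move=> fp0 fa; apply: DeriveDef.
  by apply: derivableV => //; exact: ex_derive.
rewrite (deriveV fp0) ?derive_val; last exact: ex_derive.
by rewrite /GRing.scale /= expr2 invfM -mulrA mulNr mulNr mulrC.
Qed.

(** Reduces a directional derivative to an ordinary one, so that the mean
    value theorem and the chain rule become available. *)
Lemma isd_slice p v f t : derivable f (p + t *: v) v ->
  is_derive t 1 (fun s => f (p + s *: v)) ('D_v f (p + t *: v)).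
Proof.
move=> df.
have E : (fun h : R => h^-1 *: (((fun s => f (p + s *: v)) \o shift t) (h *: (1:R^o)) - f (p + t *: v)))
  = (fun h => h^-1 *: ((f \o shift (p + t *: v)) (h *: v) - f (p + t *: v))).
  apply/funext => h /=; congr (_ *: (f _ - _)).
  by rewrite scalerDl [h *: 1]mulr1 addrCA.
apply: DeriveDef; first by rewrite /derivable E.
by rewrite /derive E.
Qed.

Lemma isd_comp p v f (h : R -> R) a b : is_derive (f p) 1 h b ->
  is_derive p v f a -> is_derive p v (fun q => h (f q)) (b * a).
Proof.
move=> hb fa.
pose k t := f (p + t *: v).
have ka : is_derive (0 : R) 1 k a.
  have : derivable f (p + 0 *: v) v by rewrite scale0r addr0; exact: ex_derive.
  by move/isd_slice; rewrite scale0r addr0 derive_val.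
have hk : is_derive (0 : R) 1 (h \o k) (b * a).
  by apply: is_derive1_comp; rewrite /k scale0r addr0.
have E : (fun e : R => e^-1 *: (((fun q => h (f q)) \o shift p) (e *: v) - h (f p))) =
  (fun e : R => e^-1 *: (((h \o k) \o shift 0) (e *: (1:R^o)) - (h \o k) 0)).
  apply/funext => e /=; rewrite /k !addr0 [e *: 1]mulr1.
  by rewrite [_ + p]addrC scale0r addr0.
apply: DeriveDef; first by rewrite /derivable E; exact: ex_derive.
by rewrite /derive E; exact: derive_val.
Qed.

Lemma isd_exp p v f a : is_derive p v f a ->
  is_derive p v (fun q => expR (f q)) (expR (f p) * a).
Proof. by move=> fa; apply: (@isd_comp p v f (@expR R)). Qed.

Lemma isd_ln p v f a : 0 < f p -> is_derive p v f a ->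
  is_derive p v (fun q => ln (f q)) ((f p)^-1 * a).
Proof.
move=> f0 fa; apply: (@isd_comp p v f (@ln R)) => //.
exact: is_derive1_ln.
Qed.

Lemma isd_ext p v f g a : (\near p, f p = g p) -> is_derive p v f a ->
  is_derive p v g a.
Proof. by move=> /near_eq_is_derive; exact. Qed.

End DirectionalDerivatives.

(** * Algebra of C^k functions *)

Section SmoothFunctions.
Context {R : realType} {n : nat}.
Local Notation E := 'rV[R]_n.
Implicit Types (V W : set E) (f g : E -> R) (p q : E) (i j : 'I_n).

Lemma pdE i f p d : is_derive p (delta_mx 0 i) f d -> pd i f p = d.
Proof. by move=> H; rewrite /pd derive_val. Qed.

(** Derivatives only see germs: the geometric identities below hold on an open
    set, not on the whole space. *)
Lemma isd_open V i f g p d : open V -> V p -> (forall q, V q -> f q = g q) ->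
  is_derive p (delta_mx 0 i : E) f d -> is_derive p (delta_mx 0 i : E) g d.
Proof.
move=> oV Vp fg; apply: isd_ext.
by near=> q; apply: fg; near: q; exact: open_nbhs_nbhs.
Unshelve. all: by end_near. Qed.

Lemma isd_coord i j p : is_derive p (delta_mx 0 i) (fun q : E => q 0 j) (i == j)%:R.
Proof.
apply: DeriveDef.
  apply: diff_derivable; exact: differentiable_coord.
rewrite /derive; apply: cvg_lim => //.
apply: cvg_near_cst; near=> h => /=.
have h0 : h != 0 by near: h; exact: nbhs_dnbhs_neq.
by rewrite !mxE addrK eqxx /= /GRing.scale /= mulKf // eq_sym.
Unshelve. all: by end_near. Qed.

Lemma CkS k V f : Ck k.+1 V f -> Ck k V f.
Proof.
elim: k f => [|k IH] f [fc fd]; first by split.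
by split=> // i; have [di ck] := fd i; split=> //; exact: IH.
Qed.

Lemma Ck_cont k V f p : Ck k V f -> V p -> {for p, continuous f}.
Proof. by case: k => [|k] [fc _]; exact: fc. Qed.

Lemma Ck_isd k V f p i : Ck k.+1 V f -> V p ->
  is_derive p (delta_mx 0 i) f (pd i f p).
Proof. by move=> [_ fd] Vp; apply: DeriveDef => //; exact: (fd i).1. Qed.

Lemma cont_open V f g p : open V -> V p -> (forall q, V q -> f q = g q) ->
  {for p, continuous f} -> {for p, continuous g}.
Proof.
move=> oV Vp fg fc; change (g q @[q --> p] --> g p); rewrite -fg //.
have H : {near p, f =1 g}.
  by near=> q; apply: fg; near: q; exact: open_nbhs_nbhs.
exact: cvg_trans (near_eq_cvg H) fc.
Unshelve. all: by end_near. Qed.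

Lemma Ck_ext k V f g : open V -> (forall p, V p -> f p = g p) ->
  Ck k V f -> Ck k V g.
Proof.
move=> oV; elim: k f g => [|k IH] f g fg fk.
  split=> // p Vp; exact (cont_open oV Vp fg (Ck_cont fk Vp)).
split=> [p Vp|i]; first exact: cont_open oV Vp fg (Ck_cont fk Vp).
have gd p : V p -> is_derive p (delta_mx 0 i) g (pd i f p).
  by move=> Vp; exact: isd_open oV Vp fg (Ck_isd i fk Vp).
split=> [p /gd|]; first by move=> ?; exact: ex_derive.
apply: IH (fk.2 i).2 => p /gd H.
by apply/esym/pdE.
Qed.

(** The induction step of every closure property below: derivatives need only
    be identified on the open set. *)
Lemma Ck_intro k V f (f' : 'I_n -> E -> R) : open V ->
  (forall p, V p -> {for p, continuous f}) ->
  (forall p i, V p -> is_derive p (delta_mx 0 i) f (f' i p)) ->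
  (forall i, Ck k V (f' i)) -> Ck k.+1 V f.
Proof.
move=> oV fc fd fk; split=> // i; split=> [p Vp|].
  by have H := fd p i Vp; exact: ex_derive.
apply: Ck_ext oV _ (fk i) => p Vp.
by apply/esym/pdE; exact: fd.
Qed.

Lemma Ck_sub k V W f : W `<=` V -> Ck k V f -> Ck k W f.
Proof.
move=> WV; elim: k f => [|k IH] f [fc fd]; first by split=> // p /WV/fc.
split=> [p /WV/fc//|i].
by have [di ck] := fd i; split=> [p /WV/di|]//; exact: IH.
Qed.

Lemma Ck_cst k V (c : R) : Ck k V (fun=> c).
Proof.
elim: k c => [|k IH] c; first by split=> // p _; exact: cst_continuous.
split=> [p _|i]; first exact: cst_continuous.
split=> [p _|]; first exact: derivable_cst.
suff -> : pd i (fun=> c) = fun=> 0 by exact: IH.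
apply/funext => p; apply: pdE; apply isd_cst.
Qed.

Lemma Ck_coord k V j : open V -> Ck k V (fun q => q 0 j).
Proof.
move=> oV; have cj p : {for p, continuous (fun q : E => q 0 j)}.
  exact: coord_continuous.
case: k => [|k]; first by split=> // p _; exact: cj.
apply: (@Ck_intro _ _ _ (fun i _ => (i == j)%:R)) => //.
by move=> p i _; exact: isd_coord.
by move=> i; exact: Ck_cst.
Qed.

Lemma Ck_add k V f g : open V -> Ck k V f -> Ck k V g ->
  Ck k V (fun q => f q + g q).
Proof.
move=> oV; elim: k f g => [|k IH] f g fk gk.
  by split=> // p Vp; apply: continuousD; [exact: Ck_cont fk Vp|exact: Ck_cont gk Vp].
apply: (@Ck_intro _ _ _ (fun i q => pd i f q + pd i g q)) => // [p Vp|p i Vp|i].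
- by apply: continuousD; [exact: Ck_cont fk Vp|exact: Ck_cont gk Vp].
- by apply: isd_add; [exact: Ck_isd _ fk Vp|exact: Ck_isd _ gk Vp].
- by apply: IH; [exact: (fk.2 i).2|exact: (gk.2 i).2].
Qed.

Lemma Ck_mul k V f g : open V -> Ck k V f -> Ck k V g ->
  Ck k V (fun q => f q * g q).
Proof.
move=> oV; elim: k f g => [|k IH] f g fk gk.
  by split=> // p Vp; apply: continuousM; [exact: Ck_cont fk Vp|exact: Ck_cont gk Vp].
apply: (@Ck_intro _ _ _ (fun i q => pd i f q * g q + f q * pd i g q)) => // [p Vp|p i Vp|i].
- by apply: continuousM; [exact: Ck_cont fk Vp|exact: Ck_cont gk Vp].
- by apply: isd_mul; [exact: Ck_isd _ fk Vp|exact: Ck_isd _ gk Vp].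
- apply: Ck_add => //; apply: IH; do ?exact: CkS; [exact: (fk.2 i).2|exact: (gk.2 i).2].
Qed.

(** Each derivative of 1 / f contains 1 / f again, but at one order less. *)
Lemma Ck_inv k V f : open V -> (forall p, V p -> f p != 0) -> Ck k V f ->
  Ck k V (fun q => (f q)^-1).
Proof.
move=> oV f0; elim: k => [|k IH] fk.
  by split=> // p Vp; apply: continuousV; [exact: f0|exact: Ck_cont fk Vp].
have fk' := IH (CkS fk).
apply: (@Ck_intro _ _ _ (fun i q => - pd i f q * (f q)^-1 * (f q)^-1)) => // [p Vp|p i Vp|i].
- by apply: continuousV; [exact: f0|exact: Ck_cont fk Vp].
- by apply: isd_inv; [exact: f0|exact: Ck_isd _ fk Vp].
- do 2!apply: Ck_mul => //.
  apply: (@Ck_ext _ _ (fun q => (-1) * pd i f q)) => // [q _|]; first by rewrite mulN1r.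
  by apply: Ck_mul => //; [exact: Ck_cst|exact: (fk.2 i).2].
Qed.

Lemma Ck_ln k V f : open V -> (forall p, V p -> 0 < f p) -> Ck k V f ->
  Ck k V (fun q => ln (f q)).
Proof.
move=> oV f0 fk.
have cf p : V p -> {for p, continuous (fun q => ln (f q))}.
  move=> Vp; apply: (@continuous_comp _ _ _ f (@ln R)); first exact: Ck_cont fk Vp.
  by apply: continuous_ln; exact: f0.
case: k fk => [|k] fk; first by split.
apply: (@Ck_intro _ _ _ (fun i q => (f q)^-1 * pd i f q)) => // [p i Vp|i].
  by apply: isd_comp; [exact: is_derive1_ln (f0 _ Vp)|exact: Ck_isd _ fk Vp].
apply: Ck_mul => //; last exact: (fk.2 i).2.
apply: Ck_inv => // [p /f0|]; first by move/lt0r_neq0.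
exact: CkS.
Qed.

Lemma Ck_exp k V f : open V -> Ck k V f -> Ck k V (fun q => expR (f q)).
Proof.
move=> oV; elim: k => [|k IH] fk.
  split=> // p Vp; apply: (@continuous_comp _ _ _ f (@expR R)); first exact: Ck_cont fk Vp.
  exact: continuous_expR.
have fk' := IH (CkS fk).
apply: (@Ck_intro _ _ _ (fun i q => expR (f q) * pd i f q)) => // [p Vp|p i Vp|i].
- apply: (@continuous_comp _ _ _ f (@expR R)); first exact: Ck_cont fk Vp.
  exact: continuous_expR.
- by apply: isd_comp; exact: Ck_isd _ fk Vp.
- by apply: Ck_mul => //; exact: (fk.2 i).2.
Qed.

End SmoothFunctions.

(** A sealed synonym of [pd]: comparing two derivatives then never unfolds the
    limits that define them. *)
HB.lock Definition partial {R : realType} {n : nat} (i : 'I_n)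
  (f : 'rV[R]_n -> R) : 'rV[R]_n -> R := pd i f.

Section SmoothCalculus.
Context {R : realType} {n : nat}.
Local Notation E := 'rV[R]_n.
Implicit Types (V W : set E) (f g : E -> R) (p q : E) (i j : 'I_n).

Lemma partialE i f : partial i f = pd i f.
Proof. by rewrite partial.unlock. Qed.

Lemma partialP i f p d : is_derive p (delta_mx 0 i) f d -> partial i f p = d.
Proof. by move=> /pdE <-; rewrite partialE. Qed.

Lemma smooth_partial V f i : smooth V f -> smooth V (partial i f).
Proof. by move=> fs k; rewrite partialE; exact: ((fs k.+1).2 i).2. Qed.

Lemma smooth_isd V f i p : smooth V f -> V p ->
  is_derive p (delta_mx 0 i) f (partial i f p).
Proof. by move=> fs; rewrite partialE; apply: Ck_isd (fs 1%N). Qed.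

Lemma smooth_cont V f p : smooth V f -> V p -> {for p, continuous f}.
Proof. by move=> fs; apply: Ck_cont (fs 0%N). Qed.

Lemma smooth_ext V f g : open V -> (forall p, V p -> f p = g p) ->
  smooth V f -> smooth V g.
Proof. by move=> oV fg fs k; exact: Ck_ext oV fg (fs k). Qed.

Lemma smooth_sub V W f : W `<=` V -> smooth V f -> smooth W f.
Proof. by move=> WV fs k; exact: Ck_sub WV (fs k). Qed.

Lemma smooth_cst V (c : R) : smooth V (fun=> c).
Proof. by move=> k; exact: Ck_cst. Qed.

Lemma smooth_coord V j : open V -> smooth V (fun q => q 0 j).
Proof. by move=> oV k; exact: Ck_coord. Qed.

Lemma smooth_add V f g : open V -> smooth V f -> smooth V g ->
  smooth V (fun q => f q + g q).
Proof. by move=> oV fs gs k; exact: Ck_add. Qed.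

Lemma smooth_mul V f g : open V -> smooth V f -> smooth V g ->
  smooth V (fun q => f q * g q).
Proof. by move=> oV fs gs k; exact: Ck_mul. Qed.

Lemma smooth_opp V f : open V -> smooth V f -> smooth V (fun q => - f q).
Proof.
move=> oV fs; apply: (@smooth_ext _ (fun q => -1 * f q)) => // [q _|].
  by rewrite mulN1r.
by apply: smooth_mul => //; exact: smooth_cst.
Qed.

Lemma smooth_ln V f : open V -> (forall p, V p -> 0 < f p) -> smooth V f ->
  smooth V (fun q => ln (f q)).
Proof. by move=> oV f0 fs k; exact: Ck_ln. Qed.

Lemma smooth_exp V f : open V -> smooth V f -> smooth V (fun q => expR (f q)).
Proof. by move=> oV fs k; exact: Ck_exp. Qed.

(** Small closed squares at p in a coordinate plane, the domain on which the
    mean value theorem is applied. *)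
Lemma nbhs_plane (p : E) i j (U : set E) : nbhs p U ->
  exists2 h : R, 0 < h &
    forall s t, 0 <= s <= h -> 0 <= t <= h ->
      U (p + s *: delta_mx 0 i + t *: delta_mx 0 j).
Proof.
move=> /nbhs_ballP[e /= e0 eU].
set a := `|delta_mx 0 i : E|; set b := `|delta_mx 0 j : E|.
have ab : 0 < 1 + a + b by rewrite -addrA ltr_pwDl // addr_ge0 // normr_ge0.
exists (e / 2 / (1 + a + b)); first by rewrite !divr_gt0.
move=> s t /andP[s0 sh] /andP[t0 th]; apply: eU.
rewrite -ball_normE /= !opprD !addrA subrr add0r -opprD normrN.
apply: (le_lt_trans (ler_normD _ _)); rewrite !normrZ -/a -/b.
rewrite (ger0_norm s0) (ger0_norm t0).
set h := e / 2 / _ in sh th.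
have h0 : 0 <= h by exact: le_trans s0 sh.
apply: (@le_lt_trans _ _ (h * (1 + a + b))).
  rewrite mulrDr mulrDr mulr1.
  have := ler_wpM2r (normr_ge0 _ : 0 <= a) sh.
  have := ler_wpM2r (normr_ge0 _ : 0 <= b) th.
  lra.
by rewrite /h divfK ?gt_eqF // ltr_pdivrMr //; lra.
Qed.

Lemma MVT_slice f i p t : 0 < t ->
  (forall s, 0 <= s <= t -> derivable f (p + s *: delta_mx 0 i) (delta_mx 0 i)) ->
  exists2 c, 0 <= c <= t &
    f (p + t *: delta_mx 0 i) - f p = partial i f (p + c *: delta_mx 0 i) * t.
Proof.
move=> t0 fd.
pose G (s : R) := f (p + s *: delta_mx 0 i).
have Gd (s : R) : s \in `[0, t] -> is_derive s 1 G (partial i f (p + s *: delta_mx 0 i)).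
  by rewrite in_itv /= partialE => st; apply: isd_slice; exact: fd.
have Gc : {within `[0, t], continuous G}.
  apply: derivable_within_continuous => s st.
  by have H := Gd s st; exact: ex_derive.
have [c] := MVT t0 (fun s st => Gd s (subset_itv_oo_cc st)) Gc.
rewrite in_itv /= => /andP[c0 ct] E.
exists c; first by rewrite !ltW.
by rewrite -[t in RHS]subr0 -E /G scale0r addr0.
Qed.

(** The mixed second difference over a square is a mixed derivative at some
    point of it; it is symmetric in i and j, which is what makes partial
    derivatives commute. *)
Lemma MVT_square V f i j p h : smooth V f -> 0 < h ->
  (forall s t, 0 <= s <= h -> 0 <= t <= h ->
      V (p + s *: delta_mx 0 i + t *: delta_mx 0 j)) ->
  exists2 cd : R * R, (0 <= cd.1 <= h) && (0 <= cd.2 <= h) &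
    f (p + h *: delta_mx 0 i + h *: delta_mx 0 j) - f (p + h *: delta_mx 0 i)
      - f (p + h *: delta_mx 0 j) + f p
    = partial j (partial i f) (p + cd.1 *: delta_mx 0 i + cd.2 *: delta_mx 0 j) * h ^+ 2.
Proof.
move=> fs h0 hV.
have hh : 0 <= h <= h by rewrite lexx ltW.
have h00 : 0 <= (0 : R) <= h by rewrite lexx ltW.
pose G s := f (p + h *: delta_mx 0 j + s *: delta_mx 0 i) - f (p + s *: delta_mx 0 i).
have Gd s : s \in `[0, h] -> is_derive s 1 G
    (partial i f (p + s *: delta_mx 0 i + h *: delta_mx 0 j) -
     partial i f (p + s *: delta_mx 0 i)).
  rewrite in_itv /= partialE => sh; apply: isd_add.
    rewrite addrAC; apply: isd_slice; rewrite addrAC.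
    exact: @ex_derive _ _ _ _ _ _ _ (smooth_isd i fs (hV _ _ sh hh)).
  apply: isd_opp; apply: isd_slice.
  have := hV _ _ sh h00; rewrite scale0r addr0 => Vp.
  exact: @ex_derive _ _ _ _ _ _ _ (smooth_isd i fs Vp).
have Gc : {within `[0, h], continuous G}.
  apply: derivable_within_continuous => s st.
  by have H := Gd s st; exact: ex_derive.
have [c] := MVT h0 (fun s st => Gd s (subset_itv_oo_cc st)) Gc.
rewrite in_itv /= => /andP[/ltW c0 /ltW ct] E.
have ch : 0 <= c <= h by rewrite c0.
have [//|s sh|d dh Ed] := @MVT_slice (partial i f) j (p + c *: delta_mx 0 i) h.
  exact: @ex_derive _ _ _ _ _ _ _ (smooth_isd j (smooth_partial i fs) (hV _ _ ch sh)).
exists (c, d) => /=; first by rewrite ch dh.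
rewrite expr2 mulrA -Ed -[X in _ * X]subr0 -E /G scale0r !addr0.
by rewrite [p + _ + h *: delta_mx 0 i]addrAC; ring.
Qed.

(** Both mixed derivatives are limits of the same difference quotient, the
    second difference over a shrinking square divided by its area. *)
Lemma partial_comm V f i j p : open V -> smooth V f -> V p ->
  partial i (partial j f) p = partial j (partial i f) p.
Proof.
move=> oV fs Vp; apply/eqP; rewrite -subr_eq0 -normr_le0.
apply/ler_addgt0Pl => e e0; rewrite addr0.
have e20 : 0 < e / 2 by rewrite divr_gt0.
have nbA k l : nbhs p [set q | `|partial k (partial l f) p - partial k (partial l f) q| < e / 2].
  have := smooth_cont (smooth_partial k (smooth_partial l fs)) Vp.
  by move=> /cvgrPdist_lt /(_ _ e20).
have : nbhs p (V `&` ([set q | `|partial i (partial j f) p - partial i (partial j f) q| < e / 2]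
    `&` [set q | `|partial j (partial i f) p - partial j (partial i f) q| < e / 2])).
  by apply: filterI; [exact: open_nbhs_nbhs|exact: filterI].
move=> nb; have [h1 h10 H1] := nbhs_plane i j nb.
have [h2 h20 H2] := nbhs_plane j i nb.
pose h := Num.min h1 h2.
have h0 : 0 < h by rewrite lt_min h10.
have hh1 s : 0 <= s <= h -> 0 <= s <= h1.
  by move=> /andP[-> /=]; rewrite le_min => /andP[].
have hh2 s : 0 <= s <= h -> 0 <= s <= h2.
  by move=> /andP[-> /=]; rewrite le_min => /andP[].
have [[c d] /= /andP[ch dh] E1] := MVT_square fs h0
  (fun s t sh th => (H1 s t (hh1 s sh) (hh1 t th)).1).
have [[c' d'] /= /andP[ch' dh'] E2] := MVT_square fs h0
  (fun s t sh th => (H2 s t (hh2 s sh) (hh2 t th)).1).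
have [_ [_ B1]] := H1 _ _ (hh1 _ ch) (hh1 _ dh).
have [_ [B2 _]] := H2 _ _ (hh2 _ ch') (hh2 _ dh').
have hn0 : h ^+ 2 != 0 by rewrite expf_neq0 // gt_eqF.
(* Both are the same second difference over the square, divided by h^2. *)
have E : partial j (partial i f) (p + c *: delta_mx 0 i + d *: delta_mx 0 j) =
         partial i (partial j f) (p + c' *: delta_mx 0 j + d' *: delta_mx 0 i).
  apply: (mulIf hn0); apply: (etrans (esym E1)); apply: (etrans _ E2).
  by rewrite (addrAC p (h *: delta_mx 0 j)) [X in X + f p]addrAC.
move: B1 B2 => /= B1 B2; rewrite -E in B2.
apply: (le_trans (ler_distD (partial j (partial i f) (p + c *: delta_mx 0 i + d *: delta_mx 0 j)) _ _)).
rewrite [e]splitr; apply: lerD; first exact: ltW B2.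
by rewrite distrC; exact: ltW B1.
Qed.

End SmoothCalculus.

(** * Connection and Riemann tensor of a rescaled plane-fronted wave *)

Section PlaneWaveCurvature.
Context {R : realType}.
Local Notation E := 'rV[R]_4.

(** Canonical forms of the coordinate indices, which let the coefficient tables
    below compute. *)
Definition i_x1 : 'I_4 := @Ordinal 4 0 isT.
Definition i_x2 : 'I_4 := @Ordinal 4 1 isT.
Definition i_u : 'I_4 := @Ordinal 4 2 isT.
Definition i_r : 'I_4 := @Ordinal 4 3 isT.

Lemma ord4_ind (P : 'I_4 -> Prop) : P i_x1 -> P i_x2 -> P i_u -> P i_r -> forall i, P i.
Proof.
move=> P0 P1 P2 P3 [[|[|[|[|//]]]] lt4];
  [move: P0|move: P1|move: P2|move: P3]; congr P; exact: val_inj.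
Qed.

Lemma sum_ord4 (F : 'I_4 -> R) : \sum_i F i = F i_x1 + F i_x2 + F i_u + F i_r.
Proof.
rewrite !big_ord_recl big_ord0 addr0 !addrA.
by congr (F _ + F _ + F _ + F _); exact: val_inj.
Qed.

(** Coefficients of dx1^2 + dx2^2 + 2 du dr. *)
Definition eta (i j : nat) : R :=
  match i, j with 0%N, 0%N | 1%N, 1%N | 2%N, 3%N | 3%N, 2%N => 1 | _, _ => 0 end.

Definition du2 (i j : nat) : R := match i, j with 2%N, 2%N => 1 | _, _ => 0 end.
(** Coefficients of the square of the vector field d/dr; the inverse of
    [eta] + 2 H [du2] is [eta] - 2 H [dr2]. *)
Definition dr2 (i j : nat) : R := match i, j with 3%N, 3%N => 1 | _, _ => 0 end.

Definition brinkmann (H : E -> R) (p : E) : 'M[R]_4 :=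
  \matrix_(i, j) (eta i j + 2 * H p * du2 i j).

Definition kron (i j : nat) : R :=
  match i, j with 0%N, 0%N | 1%N, 1%N | 2%N, 2%N | 3%N, 3%N => 1 | _, _ => 0 end.

(** Raises the index of a covector by the inverse of the unscaled metric. *)
Definition raise (h : R) (y : 'I_4 -> R) (k : nat) : R :=
  match k with
  | 0%N => y i_x1 | 1%N => y i_x2 | 2%N => y i_r | _ => y i_u - 2 * h * y i_r
  end.

(** Christoffel symbols of the unscaled metric; dh is the differential of H. *)
Definition brinkmann_chr (dh : 'I_4 -> R) (k i j : nat) : R :=
  match k, i, j with
  | 3%N, 2%N, 2%N => dh i_u
  | 3%N, 2%N, 0%N | 3%N, 0%N, 2%N => dh i_x1
  | 3%N, 2%N, 1%N | 3%N, 1%N, 2%N => dh i_x2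
  | 0%N, 2%N, 2%N => - dh i_x1
  | 1%N, 2%N, 2%N => - dh i_x2
  | _, _, _ => 0
  end.

Variables (V : set E) (H Y : E -> R).
Hypotheses (oV : open V) (Hs : smooth V H) (Ys : smooth V Y).
Hypothesis r_free : forall p, V p -> partial i_r H p = 0.

Local Notation g := (rescale Y (brinkmann H)).

(** The usual law: a conformal change by exp(2 Y) adds
    delta^k_i Y_j + delta^k_j Y_i - g_ij Y^k to the Christoffel symbols. *)
Definition conf_chr (k i j : 'I_4) (p : E) : R :=
  kron i k * partial j Y p + kron j k * partial i Y p
  - (eta i j + 2 * H p * du2 i j) * raise (H p) (fun l => partial l Y p) k
  + brinkmann_chr (fun l => partial l H p) k i j.

Definition dconf_chr (m k i j : 'I_4) (p : E) : R :=
  kron i k * partial m (partial j Y) p + kron j k * partial m (partial i Y) p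
  - (2 * partial m H p * du2 i j) * raise (H p) (fun l => partial l Y p) k
  - (eta i j + 2 * H p * du2 i j) *
     (raise (H p) (fun l => partial m (partial l Y) p) k - 2 * partial m H p * dr2 k 3 * partial i_r Y p)
  + brinkmann_chr (fun l => partial m (partial l H) p) k i j.

Lemma rescaleE (p : E) i j :
  g p i j = expR (2 * Y p) * (eta i j + 2 * H p * du2 i j).
Proof. by rewrite /rescale !mxE. Qed.

Lemma ginv_rescale p i j :
  ginv g p i j = (expR (2 * Y p))^-1 * (eta i j - 2 * H p * dr2 i j).
Proof.
set B : 'M[R]_4 := \matrix_(i, j) ((expR (2 * Y p))^-1 * (eta i j - 2 * H p * dr2 i j)).
have e0 : expR (2 * Y p) != 0 by rewrite gt_eqF // expR_gt0.
have gB : g p *m B = 1%:M.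
  apply/matrixP; elim/ord4_ind => //; elim/ord4_ind => //;
    by rewrite mxE sum_ord4 !rescaleE !mxE /=; field.
rewrite /ginv; suff -> : invmx (g p) = B by rewrite mxE.
have [gu _] := mulmx1_unit gB.
by rewrite -[LHS]mulmx1 -gB mulKmx.
Qed.

Lemma isd_metric (p : E) m i j : V p ->
  is_derive p (delta_mx 0 m) (fun q => g q i j)
    (expR (2 * Y p) * (2 * partial m Y p * (eta i j + 2 * H p * du2 i j)
                       + 2 * partial m H p * du2 i j)).
Proof.
move=> Vp.
have -> : (fun q => g q i j) =
    (fun q => expR (2 * Y q) * (eta i j + 2 * H q * du2 i j)).
  by apply/funext => q; exact: rescaleE.
have HY := smooth_isd m Ys Vp; have HH := smooth_isd m Hs Vp.
apply: (is_derive_eq (isd_mul (isd_exp (isd_mul (isd_cst _ _ 2) HY))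
  (isd_add (isd_cst _ _ (eta i j))
    (isd_mul (isd_mul (isd_cst _ _ 2) HH) (isd_cst _ _ (du2 i j)))))).
rewrite /=; ring.
Qed.

(** The factors exp(2 Y) of the metric and exp(- 2 Y) of its inverse cancel,
    so that the symbols are polynomial in the jets of H and Y. *)
Lemma christoffelE (p : E) k i j : V p -> christoffel g k i j p = conf_chr k i j p.
Proof.
move=> Vp; rewrite /christoffel sum_ord4 -!partialE !ginv_rescale.
rewrite !(partialP (isd_metric _ _ _ Vp)) /conf_chr.
have e0 : expR (2 * Y p) != 0 by rewrite gt_eqF // expR_gt0.
have H3 := r_free Vp.
elim/ord4_ind: k; elim/ord4_ind: i; elim/ord4_ind: j; rewrite /= ?H3;
  move: (expR _) e0 (H p) (partial i_x1 H p) (partial i_x2 H p) (partial i_u H p)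
    (partial i_x1 Y p) (partial i_x2 Y p) (partial i_u Y p) (partial i_r Y p) => *; by field.
Qed.

Lemma isd_conf_chr (p : E) m k i j : V p ->
  is_derive p (delta_mx 0 m) (conf_chr k i j) (dconf_chr m k i j p).
Proof.
move=> Vp.
have HY l := smooth_isd m (smooth_partial l Ys) Vp.
have HH l := smooth_isd m (smooth_partial l Hs) Vp.
have H0 := smooth_isd m Hs Vp.
have Hw : is_derive p (delta_mx 0 m) (fun q => brinkmann_chr (fun l => partial l H q) k i j)
   (brinkmann_chr (fun l => partial m (partial l H) p) k i j).
  by elim/ord4_ind: k; elim/ord4_ind: i; elim/ord4_ind: j; rewrite /=;
    first [exact: isd_cst|exact: HH|by apply: isd_opp; exact: HH].
have Hr : is_derive p (delta_mx 0 m) (fun q => raise (H q) (fun l => partial l Y q) k)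
   (raise (H p) (fun l => partial m (partial l Y) p) k - 2 * partial m H p * dr2 k 3 * partial i_r Y p).
  elim/ord4_ind: k {Hw}; rewrite /= ?mulr0 ?mul0r ?subr0; try exact: HY.
  apply: (is_derive_eq (isd_add (HY i_u)
    (isd_opp (isd_mul (isd_mul (isd_cst _ _ 2) H0) (HY i_r))))).
  move: (@partial R 4) => P /=; ring.
apply: (is_derive_eq (isd_add (isd_add
    (isd_add (isd_mul (isd_cst _ _ (kron i k)) (HY j))
             (isd_mul (isd_cst _ _ (kron j k)) (HY i)))
    (isd_opp (isd_mul (isd_add (isd_cst _ _ (eta i j))
      (isd_mul (isd_mul (isd_cst _ _ 2) H0) (isd_cst _ _ (du2 i j)))) Hr))) Hw)).
rewrite /dconf_chr /=.
move: (@partial R 4) => P.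
move: (raise _ (fun=> P m _ _) _) (raise _ _ _) (brinkmann_chr _ _ _ _) => r1 r2 w; ring.
Qed.

Lemma pd_christoffel (p : E) m k i j : V p ->
  partial m (christoffel g k i j) p = dconf_chr m k i j p.
Proof.
move=> Vp; apply: partialP; apply: isd_open oV Vp _ (isd_conf_chr m k i j Vp).
by move=> q Vq; rewrite christoffelE.
Qed.

Lemma riemannE (p : E) l k i j : V p ->
  riemann g l k i j p =
  dconf_chr i l j k p - dconf_chr j l i k p
  + ((conf_chr l i i_x1 p * conf_chr i_x1 j k p
     - conf_chr l j i_x1 p * conf_chr i_x1 i k p)
  + (conf_chr l i i_x2 p * conf_chr i_x2 j k p
     - conf_chr l j i_x2 p * conf_chr i_x2 i k p)
  + (conf_chr l i i_u p * conf_chr i_u j k p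
     - conf_chr l j i_u p * conf_chr i_u i k p)
  + (conf_chr l i i_r p * conf_chr i_r j k p
     - conf_chr l j i_r p * conf_chr i_r i k p)).
Proof.
move=> Vp; rewrite /riemann -!partialE !pd_christoffel //.
under eq_bigr => m _ do rewrite !(christoffelE _ _ _ Vp).
by rewrite sum_ord4.
Qed.

End PlaneWaveCurvature.

(** * Ricci tensor *)

Section ConformalRicci.
Context {R : realType}.
Local Notation E := 'rV[R]_4.
Variables (V : set E) (H Y : E -> R).
Hypotheses (oV : open V) (Hs : smooth V H) (Ys : smooth V Y).
Hypothesis r_free : forall p, V p -> partial i_r H p = 0.

Local Notation g := (rescale Y (brinkmann H)).

Definition laplacian (p : E) : R := partial i_x1 (partial i_x1 H) p + partial i_x2 (partial i_x2 H) p.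

(** The part of the Schouten tensor of exp(2 Y) g that is not a multiple of g:
    dY (x) dY - Hess Y + P, where P = - (L / 2) du^2 is the Schouten tensor
    of g and L the Laplacian of H. *)
Definition conf_hess (i j : 'I_4) (p : E) : R :=
  partial i Y p * partial j Y p - partial i (partial j Y) p
  + \sum_(l < 4) brinkmann_chr (fun m => partial m H p) l i j * partial l Y p
  - 2^-1 * laplacian p * du2 i j.

Definition grad_norm2 (p : E) : R :=
  partial i_x1 Y p ^+ 2 + partial i_x2 Y p ^+ 2 + 2 * partial i_u Y p * partial i_r Y p
  - 2 * H p * partial i_r Y p ^+ 2.

(** Trace of the Hessian of Y; no first order term occurs because the
    Christoffel symbols of the unscaled metric are trace-free. *)
Definition dalembertian (p : E) : R :=
  partial i_x1 (partial i_x1 Y) p + partial i_x2 (partial i_x2 Y) p + 2 * partial i_u (partial i_r Y) p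
  - 2 * H p * partial i_r (partial i_r Y) p.

Lemma partial_partial_r m p : V p -> partial m (partial i_r H) p = 0.
Proof.
move=> Vp; apply: partialP.
by apply: (isd_open oV Vp) (isd_cst _ _ 0) => q Vq; rewrite r_free.
Qed.

Lemma partial_r_partial m p : V p -> partial i_r (partial m H) p = 0.
Proof. by move=> Vp; rewrite (partial_comm _ _ oV) // partial_partial_r. Qed.

(** The conformal transformation law of the Ricci tensor in dimension four. *)
Lemma ricciE k j p : V p ->
  ricci g k j p = 2 * conf_hess k j p
    - (dalembertian p + 2 * grad_norm2 p) * (eta k j + 2 * H p * du2 k j).
Proof.
move=> Vp.
have C f i l : smooth V f -> partial i (partial l f) p = partial l (partial i f) p.
  by move=> fs; exact: (partial_comm _ _ oV fs Vp).
have Y10 := C _ i_x2 i_x1 Ys; have Y20 := C _ i_u i_x1 Ys; have Y30 := C _ i_r i_x1 Ys.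
have Y21 := C _ i_u i_x2 Ys; have Y31 := C _ i_r i_x2 Ys; have Y32 := C _ i_r i_u Ys.
have H10 := C _ i_x2 i_x1 Hs; have H20 := C _ i_u i_x1 Hs; have H21 := C _ i_u i_x2 Hs.
have H03 := partial_partial_r i_x1 Vp; have H13 := partial_partial_r i_x2 Vp; have H23 := partial_partial_r i_u Vp.
have H30 := partial_r_partial i_x1 Vp; have H31 := partial_r_partial i_x2 Vp; have H32 := partial_r_partial i_u Vp.
have H33 := partial_partial_r i_r Vp; have H3 := r_free Vp.
rewrite /ricci sum_ord4 !(riemannE oV Hs Ys r_free _ _ _ _ Vp).
rewrite /conf_hess /dalembertian /grad_norm2 /laplacian sum_ord4.
rewrite /conf_chr /dconf_chr.
move: (@partial R 4) C Y10 Y20 Y30 Y21 Y31 Y32 H10 H20 H21 H03 H13 H23 H30 H31 H32 H33 H3 => P _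
  Y10 Y20 Y30 Y21 Y31 Y32 H10 H20 H21 H03 H13 H23 H30 H31 H32 H33 H3.
elim/ord4_ind: k; elim/ord4_ind: j; rewrite /=
  ?Y10 ?Y20 ?Y30 ?Y21 ?Y31 ?Y32 ?H10 ?H20 ?H21 ?H03 ?H13 ?H23 ?H30 ?H31 ?H32
  ?H33 ?H3; by first [ring | field].
Qed.

End ConformalRicci.

(** * Scalar curvature and Schouten tensor *)

Section ConformalSchouten.
Context {R : realType}.
Local Notation E := 'rV[R]_4.
Variables (V : set E) (H Y : E -> R).
Hypotheses (oV : open V) (Hs : smooth V H) (Ys : smooth V Y).
Hypothesis r_free : forall p, V p -> partial i_r H p = 0.

Local Notation g := (rescale Y (brinkmann H)).

Lemma conf_hessC i j p : V p -> conf_hess H Y i j p = conf_hess H Y j i p.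
Proof.
move=> Vp; rewrite /conf_hess (partial_comm i j oV Ys Vp) (mulrC (partial j Y p)).
congr (_ + _ - _); last by elim/ord4_ind: i; elim/ord4_ind: j.
by apply: eq_bigr => l _; elim/ord4_ind: l; elim/ord4_ind: i; elim/ord4_ind: j.
Qed.

Lemma conf_hess_lin (i j : 'I_4) p : (forall l : 'I_4, brinkmann_chr (fun m => partial m H p) l i j = 0) ->
  du2 i j = 0 :> R ->
  conf_hess H Y i j p = partial i Y p * partial j Y p - partial i (partial j Y) p.
Proof.
move=> w0 u0; rewrite /conf_hess u0 mulr0 subr0 big1 ?addr0 // => l _.
by rewrite w0 mul0r.
Qed.

Lemma conf_hessE p :
  [/\ conf_hess H Y i_x1 i_u p = partial i_x1 Y p * partial i_u Y p - partial i_x1 (partial i_u Y) p + partial i_x1 H p * partial i_r Y p,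
      conf_hess H Y i_x2 i_u p = partial i_x2 Y p * partial i_u Y p - partial i_x2 (partial i_u Y) p + partial i_x2 H p * partial i_r Y p &
      conf_hess H Y i_u i_u p = partial i_u Y p * partial i_u Y p - partial i_u (partial i_u Y) p - partial i_x1 H p * partial i_x1 Y p
        - partial i_x2 H p * partial i_x2 Y p + partial i_u H p * partial i_r Y p - 2^-1 * laplacian H p].
Proof.
by rewrite /conf_hess !sum_ord4 /=; move: (laplacian H p) (@partial R 4) => L P; split; ring.
Qed.

(** As scal(g) = 0, the tensor P contributes nothing to the trace. *)
Lemma conf_hess_tr p :
  conf_hess H Y i_x1 i_x1 p + conf_hess H Y i_x2 i_x2 p + 2 * conf_hess H Y i_u i_r p
   - 2 * H p * conf_hess H Y i_r i_r p = grad_norm2 H Y p - dalembertian H Y p.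
Proof.
rewrite !conf_hess_lin //; do ?by elim/ord4_ind.
by rewrite /grad_norm2 /dalembertian; move: (@partial R 4) => P; ring.
Qed.

Lemma scalE p : V p ->
  scal g p = - 6 * (expR (2 * Y p))^-1 * (dalembertian H Y p + grad_norm2 H Y p).
Proof.
move=> Vp; rewrite /scal.
under eq_bigr => i _ do
  under eq_bigr => j _ do rewrite ginv_rescale (ricciE oV Hs Ys r_free _ _ Vp).
have := conf_hess_tr p; have := conf_hessC i_r i_u Vp.
move: (conf_hess H Y) (dalembertian H Y p) (grad_norm2 H Y p) (expR _)^-1 => W b q e W32 tr.
(* Eliminates |dY|^2, leaving an identity linear in W. *)
have -> : q = W i_x1 i_x1 p + W i_x2 i_x2 p + 2 * W i_u i_r p - 2 * H p * W i_r i_r p + b.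
  by rewrite tr subrK.
rewrite !sum_ord4 /= W32; move: (H p) => h; ring.
Qed.

(** The trace terms of [ricciE] and [scalE] combine to half of |dY|^2. *)
Lemma schoutenE a b p : V p ->
  schouten g a b p = conf_hess H Y a b p
    - 2^-1 * grad_norm2 H Y p * (eta a b + 2 * H p * du2 a b).
Proof.
move=> Vp; rewrite /schouten (ricciE oV Hs Ys r_free _ _ Vp) (scalE Vp) rescaleE.
have e0 : expR (2 * Y p) != 0 by rewrite gt_eqF // expR_gt0.
move: (expR _) e0 => e e0.
move: (conf_hess _ _ _ _ _) (dalembertian _ _ _) (grad_norm2 _ _ _) (eta _ _) (du2 _ _) (H p)
  => w b' c' d' u' h.
by field.
Qed.

End ConformalSchouten.

(** * Einstein rescalings force the third derivatives of the profile to vanish *)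

Section EinsteinRigidity.
Context {R : realType}.
Local Notation E := 'rV[R]_4.

(** The form in which derivatives are computed below: an identity between
    functions on an open set is differentiated at a point of it. *)
Lemma partialP_on (V : set E) (f g : E -> R) i p d : open V -> V p ->
  (forall q, V q -> f q = g q) -> is_derive p (delta_mx 0 i) g d ->
  partial i f p = d.
Proof.
move=> oV Vp fg gd; apply: partialP; apply: isd_open oV Vp _ gd => q Vq.
by rewrite fg.
Qed.

Variables (V : set E) (H Y : E -> R).
Hypotheses (oV : open V) (Hs : smooth V H) (Ys : smooth V Y).
Hypothesis r_free : forall p, V p -> partial i_r H p = 0.

Local Notation g := (rescale Y (brinkmann H)).
Local Notation D i p := (partial i (laplacian H) p).

Hypothesis pde_re : forall p, V p ->
  p 0 i_x1 * D i_x1 p - p 0 i_x2 * D i_x2 p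
    = 2 * (partial i_x1 (partial i_x1 H) p - partial i_x2 (partial i_x2 H) p).
Hypothesis pde_im : forall p, V p ->
  p 0 i_x1 * D i_x2 p + p 0 i_x2 * D i_x1 p = 4 * partial i_x1 (partial i_x2 H) p.

Hypothesis einstein : einstein_on g V.

Let sigma q := expR (- Y q).

Lemma sigma_smooth : smooth V sigma.
Proof. by apply: smooth_exp => //; exact: smooth_opp. Qed.

Lemma pd_sigma i q : V q -> partial i sigma q = - partial i Y q * sigma q.
Proof.
move=> Vq; rewrite (partialP (isd_exp (isd_opp (smooth_isd i Ys Vq)))).
by rewrite mulrC.
Qed.

Lemma pd2_sigma i j q : V q ->
  partial i (partial j sigma) q = (partial i Y q * partial j Y q - partial i (partial j Y) q) * sigma q.
Proof.
move=> Vq; rewrite (partialP_on oV Vq (pd_sigma j)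
  (isd_mul (isd_opp (smooth_isd i (smooth_partial j Ys) Vq)) (smooth_isd i sigma_smooth Vq))).
rewrite pd_sigma //; move: (@partial R 4) (sigma q) => P s; ring.
Qed.

(** With E for [conf_hess], 2 E is the Ricci tensor up to a multiple of g, and
    E sigma = Hess sigma + sigma P: this linearises the Einstein equation. *)
Lemma einstein_conf_hess q : V q -> exists rho, forall i j,
  conf_hess H Y i j q * sigma q = rho * (eta i j + 2 * H q * du2 i j).
Proof.
move=> Vq; have [lambda lE] := einstein.
exists (2^-1 * (lambda * expR (2 * Y q) + dalembertian H Y q + 2 * grad_norm2 H Y q) * sigma q) => i j.
have := lE q Vq i j; rewrite (ricciE oV Hs Ys r_free _ _ Vq) rescaleE => e.
move: (conf_hess _ _ _ _ _) (dalembertian _ _ _) (grad_norm2 _ _ _) (expR _) (sigma q) (eta _ _ + _) e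
  => w b c x s h e.
suff -> : w = 2^-1 * (lambda * x + b + 2 * c) * h by ring.
by lra.
Qed.

Lemma conf_hess_linE q :
  let W i j := conf_hess H Y i j q = partial i Y q * partial j Y q - partial i (partial j Y) q in
  [/\ W i_x1 i_x1, W i_x1 i_x2 & W i_x1 i_r] /\ [/\ W i_x2 i_x2, W i_x2 i_r & W i_u i_r].
Proof.
by split; split; apply: conf_hess_lin => //; elim/ord4_ind.
Qed.

(** Components of Hess sigma + sigma P = rho g, where rho has been eliminated
    by means of the du dr component. *)
Lemma einstein_hess q : V q ->
  [/\ partial i_x1 (partial i_x1 sigma) q = partial i_u (partial i_r sigma) q,
      partial i_x2 (partial i_x2 sigma) q = partial i_u (partial i_r sigma) q &
      partial i_x1 (partial i_x2 sigma) q = 0] /\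
  [/\ partial i_x1 (partial i_r sigma) q = 0, partial i_x2 (partial i_r sigma) q = 0,
      partial i_x1 (partial i_u sigma) q = partial i_x1 H q * partial i_r sigma q,
      partial i_x2 (partial i_u sigma) q = partial i_x2 H q * partial i_r sigma q &
      partial i_u (partial i_u sigma) q + partial i_x1 H q * partial i_x1 sigma q + partial i_x2 H q * partial i_x2 sigma q
       - partial i_u H q * partial i_r sigma q - 2^-1 * laplacian H q * sigma q
       = 2 * H q * partial i_u (partial i_r sigma) q].
Proof.
move=> Vq; have [rho rE] := einstein_conf_hess Vq.
have [W02 W12 W22] := conf_hessE H Y q.
have [[W00 W01 W03] [W11 W13 W23]] := conf_hess_linE q.
have E00 := rE i_x1 i_x1; have E01 := rE i_x1 i_x2; have E02 := rE i_x1 i_u.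
have E03 := rE i_x1 i_r; have E11 := rE i_x2 i_x2; have E12 := rE i_x2 i_u.
have E13 := rE i_x2 i_r; have E22 := rE i_u i_u; have E23 := rE i_u i_r.
rewrite W00 in E00; rewrite W01 in E01; rewrite W02 in E02; rewrite W03 in E03.
rewrite W11 in E11; rewrite W12 in E12; rewrite W13 in E13; rewrite W22 in E22; rewrite W23 in E23.
rewrite !(pd2_sigma _ _ Vq) !(pd_sigma _ Vq).
move: {W00 W01 W02 W03 W11 W12 W13 W22 W23} E00 E01 E02 E03 E11 E12 E13 E22 E23.
rewrite /= !(mulr0, addr0, mulr1, add0r).
move: (laplacian H q) (@partial R 4) (sigma q) (H q) => L P s h E00 E01 E02 E03 E11 E12 E13 E22 E23.
split; first by split; rewrite ?E00 ?E11 ?E23 ?E01.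
split; rewrite ?E03 ?E13 //.
- apply/eqP; rewrite -subr_eq0; apply/eqP; rewrite -[RHS]E02; ring.
- apply/eqP; rewrite -subr_eq0; apply/eqP; rewrite -[RHS]E12; ring.
- by rewrite E23 [RHS]mulrC -E22; ring.
Qed.

(** The du dx^i components give sigma_ui = H_i sigma_r, and sigma_jr = 0. *)
Lemma third_derivative i j q : (i = i_x1 \/ i = i_x2) -> (j = i_x1 \/ j = i_x2) -> V q ->
  partial i_u (partial j (partial i sigma)) q
    = partial j (partial i H) q * partial i_r sigma q.
Proof.
move=> i01 j01 Vq; have ss := sigma_smooth.
have hess r : V r -> partial i_u (partial i sigma) r = partial i H r * partial i_r sigma r.
  move=> Vr; rewrite (partial_comm _ _ oV ss Vr).
  have [_ [_ _ e0 e1 _]] := einstein_hess Vr.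
  by case: i01 => ->.
rewrite (partial_comm _ _ oV (smooth_partial i ss) Vq).
rewrite (partialP_on oV Vq hess (isd_mul (smooth_isd j (smooth_partial i Hs) Vq)
  (smooth_isd j (smooth_partial i_r ss) Vq))).
have [_ [e0 e1 _ _ _]] := einstein_hess Vq.
by case: j01 => ->; rewrite ?e0 ?e1 mulr0 addr0.
Qed.

Hypothesis D_neq0 : forall q, V q -> D i_x1 q ^+ 2 + D i_x2 q ^+ 2 != 0.
Hypothesis x_neq0 : forall q, V q -> q 0 i_x1 ^+ 2 + q 0 i_x2 ^+ 2 != 0.

(** Differentiating sigma_11 = sigma_22 and sigma_12 = 0 along u shows that
    sigma_r is annihilated by H_11 - H_22 and by H_12; by the PDEs these
    do not both vanish where z and dL do not. *)
Lemma sigma_r q : V q -> partial i_r sigma q = 0.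
Proof.
move=> Vq; have ss := sigma_smooth.
have s2 i j := smooth_isd i_u (smooth_partial i (smooth_partial j ss)) Vq.
have L0 : i_x1 = i_x1 \/ i_x1 = i_x2 by left.
have L1 : i_x2 = i_x1 \/ i_x2 = i_x2 by right.
have e00 := third_derivative L0 L0 Vq; have e11 := third_derivative L1 L1 Vq.
have e01 := third_derivative L1 L0 Vq.
have E0 : partial i_u (partial i_x1 (partial i_x1 sigma)) q
        = partial i_u (partial i_x2 (partial i_x2 sigma)) q.
  apply: (partialP_on oV Vq _ (s2 i_x2 i_x2)) => r Vr.
  by have [[-> -> _] _] := einstein_hess Vr.
have E1 : partial i_u (partial i_x1 (partial i_x2 sigma)) q = 0.
  apply: (partialP_on oV Vq _ (isd_cst _ _ 0)) => r Vr.
  by have [[_ _ ->] _] := einstein_hess Vr.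
move: E0 E1; rewrite e00 e11 e01 => E0 E1.
have b0 := pde_re Vq; have b1 := pde_im Vq.
have nz : (D i_x1 q ^+ 2 + D i_x2 q ^+ 2) * (q 0 i_x1 ^+ 2 + q 0 i_x2 ^+ 2) != 0.
  by rewrite mulf_neq0 ?D_neq0 ?x_neq0.
apply: (mulfI nz); rewrite mulr0.
(* The norm of a product of two complex numbers. *)
have -> : (D i_x1 q ^+ 2 + D i_x2 q ^+ 2) * (q 0 i_x1 ^+ 2 + q 0 i_x2 ^+ 2) =
  (q 0 i_x1 * D i_x1 q - q 0 i_x2 * D i_x2 q) ^+ 2 + (q 0 i_x1 * D i_x2 q + q 0 i_x2 * D i_x1 q) ^+ 2.
  by ring.
rewrite b0 b1.
have -> : ((2 * (partial i_x1 (partial i_x1 H) q - partial i_x2 (partial i_x2 H) q)) ^+ 2 + (4 * partial i_x1 (partial i_x2 H) q) ^+ 2) *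
   partial i_r sigma q = 4 * (partial i_x1 (partial i_x1 H) q - partial i_x2 (partial i_x2 H) q) *
   (partial i_x1 (partial i_x1 H) q * partial i_r sigma q - partial i_x2 (partial i_x2 H) q * partial i_r sigma q) +
   16 * partial i_x1 (partial i_x2 H) q * (partial i_x1 (partial i_x2 H) q * partial i_r sigma q) by ring.
by rewrite E0 E1 subrr !mulr0 addr0.
Qed.

(** With sigma_r = 0 the multiple rho = sigma_ur vanishes as well. *)
Lemma sigma_affine q : V q ->
  [/\ partial i_x1 (partial i_x1 sigma) q = 0, partial i_x2 (partial i_x2 sigma) q = 0,
      partial i_x1 (partial i_x2 sigma) q = 0, partial i_x1 (partial i_u sigma) q = 0 &
      partial i_x2 (partial i_u sigma) q = 0] /\
  partial i_u (partial i_u sigma) q + partial i_x1 H q * partial i_x1 sigma q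
    + partial i_x2 H q * partial i_x2 sigma q - 2^-1 * laplacian H q * sigma q = 0.
Proof.
move=> Vq; have [[e00 e11 e01] [_ _ e02 e12 e22]] := einstein_hess Vq.
have s23 : partial i_u (partial i_r sigma) q = 0.
  apply: (partialP_on oV Vq _ (isd_cst _ _ 0)) => r Vr; exact: sigma_r.
rewrite e00 e11 e01 e02 e12 s23 (sigma_r Vq) !mulr0; split; first by [].
by move: e22; rewrite s23 (sigma_r Vq) !mulr0 subr0.
Qed.

Lemma einstein_contradiction q : ~ V q.
Proof.
have ss := sigma_smooth.
have Ls : smooth V (laplacian H).
  by apply: smooth_add => //; do 2!apply: smooth_partial.
(* Derivative of the du^2 component along x1 and x2. *)
have key i r : (i = i_x1 \/ i = i_x2) -> V r ->
  partial i (partial i_x1 H) r * partial i_x1 sigma r + partial i (partial i_x2 H) r * partial i_x2 sigma r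
  - 2^-1 * laplacian H r * partial i sigma r = 2^-1 * D i r * sigma r.
  move=> i01 Vr.
  have [[a00 a11 a01 _ _] _] := sigma_affine Vr.
  have a10 := partial_comm i_x2 i_x1 oV ss Vr.
  have ai0 : partial i (partial i_x1 sigma) r = 0 by case: i01 => ->; rewrite ?a10.
  have ai1 : partial i (partial i_x2 sigma) r = 0 by case: i01 => ->.
  have a22 : partial i (partial i_u (partial i_u sigma)) r = 0.
    rewrite (partial_comm _ _ oV (smooth_partial i_u ss) Vr).
    apply: (partialP_on oV Vr _ (isd_cst _ _ 0)) => t Vt.
    by have [[_ _ _ b c] _] := sigma_affine Vt; case: i01 => ->.
  pose F t := - (partial i_x1 H t * partial i_x1 sigma t
    + partial i_x2 H t * partial i_x2 sigma t - 2^-1 * laplacian H t * sigma t).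
  have E t : V t -> partial i_u (partial i_u sigma) t = F t.
    move=> Vt; have [_ e] := sigma_affine Vt.
    by apply/eqP; rewrite -subr_eq0 opprK !addrA e.
  have := partialP_on oV Vr E (isd_opp (isd_add (isd_add
    (isd_mul (smooth_isd i (smooth_partial i_x1 Hs) Vr) (smooth_isd i (smooth_partial i_x1 ss) Vr))
    (isd_mul (smooth_isd i (smooth_partial i_x2 Hs) Vr) (smooth_isd i (smooth_partial i_x2 ss) Vr)))
    (isd_opp (isd_mul (isd_mul (isd_cst _ _ 2^-1) (smooth_isd i Ls Vr)) (smooth_isd i ss Vr))))).
  rewrite a22 ai0 ai1 !mulr0 !addr0 => e.
  apply/eqP; rewrite -subr_eq0; apply/eqP; rewrite -[RHS]oppr0 [in RHS]e.
  move: (@partial R 4) (laplacian H) (sigma) => P L s; ring.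
(* In complex form the two equations are a multiple of (L / 2)_z, and the
   combination with coefficients dL divides by it. *)
have radial r : V r ->
  r 0 i_x1 * partial i_x1 sigma r + r 0 i_x2 * partial i_x2 sigma r = 2 * sigma r.
  move=> Vr; have L0 : i_x1 = i_x1 \/ i_x1 = i_x2 by left.
  have L1 : i_x2 = i_x1 \/ i_x2 = i_x2 by right.
  have k0 := key _ _ L0 Vr; have k1 := key _ _ L1 Vr.
  rewrite (partial_comm i_x2 i_x1 oV Hs Vr) in k1.
  have b0 := pde_re Vr; have b1 := pde_im Vr.
  apply: (mulfI (D_neq0 Vr)).
  have lE : laplacian H r = partial i_x1 (partial i_x1 H) r + partial i_x2 (partial i_x2 H) r by [].
  rewrite lE in k0 k1.
  move: (D i_x1 r) (D i_x2 r) (r 0 i_x1) (r 0 i_x2) (sigma r) k0 k1 b0 b1 => d0 d1 x0 x1 s k0 k1 b0 b1.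
  move: (partial i_x1 (partial i_x1 H) r) (partial i_x2 (partial i_x2 H) r) (partial i_x1 (partial i_x2 H) r)
    (partial i_x1 sigma r) (partial i_x2 sigma r) k0 k1 b0 b1 {lE} => h00 h11 h01 s0 s1 k0 k1 b0 b1.
  have h00E : h00 = h11 + 2^-1 * (x0 * d0 - x1 * d1) by rewrite b0; field.
  have h01E : h01 = 4^-1 * (x0 * d1 + x1 * d0) by rewrite b1; field.
  have -> : (d0 ^+ 2 + d1 ^+ 2) * (2 * s) = 4 * (d0 * (2^-1 * d0 * s) + d1 * (2^-1 * d1 * s)) by field.
  by rewrite -k0 -k1 h00E h01E; field.
(* As sigma is affine, the derivative of the radial identity reads
   sigma_i = 2 sigma_i. *)
have sdiff i r : (i = i_x1 \/ i = i_x2) -> V r -> partial i sigma r = 0.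
  move=> i01 Vr.
  have [[a00 a11 a01 _ _] _] := sigma_affine Vr.
  have a10 := partial_comm i_x2 i_x1 oV ss Vr.
  have E : partial i (fun t => t 0 i_x1 * partial i_x1 sigma t + t 0 i_x2 * partial i_x2 sigma t) r
     = 2 * partial i sigma r.
    apply: (partialP_on oV Vr radial).
    apply: (is_derive_eq (isd_mul (isd_cst _ _ 2) (smooth_isd i ss Vr))).
    by rewrite mul0r add0r.
  move: E; rewrite (partialP (isd_add
    (isd_mul (isd_coord _ _ _) (smooth_isd i (smooth_partial i_x1 ss) Vr))
    (isd_mul (isd_coord _ _ _) (smooth_isd i (smooth_partial i_x2 ss) Vr)))).
  by case: i01 => ->; rewrite ?a10 ?a00 ?a01 ?a11 /=; lra.
move=> Vq; have := radial q Vq.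
rewrite !sdiff //; [|by right|by left]; rewrite !mulr0 addr0 => /eqP.
by rewrite eq_sym mulf_eq0 pnatr_eq0 /= gt_eqF // expR_gt0.
Qed.

End EinsteinRigidity.

Section EinsteinRigidityLocal.
Context {R : realType}.
Local Notation E := 'rV[R]_4.

Lemma open_smooth_neq0 (n : nat) (V : set 'rV[R]_n) (f : 'rV[R]_n -> R) :
  open V -> smooth V f -> open (V `&` [set q | f q != 0]).
Proof.
move=> oV fs; rewrite openE => q [Vq fq]; apply: filterI.
  exact: open_nbhs_nbhs.
exact: cvgr_neq0 (smooth_cont fs Vq) fq.
Qed.

(** The points with dL <> 0 form an open set, which meets z <> 0 if it is not
    empty because z <> 0 is dense; hence it is empty. *)
Lemma einstein_rigidity (V : set E) (H Y : E -> R) : open V -> smooth V H ->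
  smooth V Y -> (forall p, V p -> partial i_r H p = 0) ->
  (forall p, V p ->
     p 0 i_x1 * partial i_x1 (laplacian H) p - p 0 i_x2 * partial i_x2 (laplacian H) p
     = 2 * (partial i_x1 (partial i_x1 H) p - partial i_x2 (partial i_x2 H) p)) ->
  (forall p, V p ->
     p 0 i_x1 * partial i_x2 (laplacian H) p + p 0 i_x2 * partial i_x1 (laplacian H) p
     = 4 * partial i_x1 (partial i_x2 H) p) ->
  einstein_on (rescale Y (brinkmann H)) V ->
  forall p, V p -> partial i_x1 (laplacian H) p = 0 /\ partial i_x2 (laplacian H) p = 0.
Proof.
move=> oV Hs Ys r_free b0 b1 [lambda ein] p Vp.
pose F q := partial i_x1 (laplacian H) q ^+ 2 + partial i_x2 (laplacian H) q ^+ 2.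
have [F0|Fn0] := eqVneq (F p) 0.
  move/eqP: F0; rewrite paddr_eq0 ?sqr_ge0 // !sqrf_eq0.
  by move=> /andP[/eqP ? /eqP].
have Ls : smooth V (laplacian H) by apply: smooth_add => //; do 2!apply: smooth_partial.
have Fs : smooth V F.
  by apply: smooth_add => //; apply: smooth_mul => //; apply: smooth_partial.
pose x2 (q : E) := q 0 i_x1 ^+ 2 + q 0 i_x2 ^+ 2.
have oU := open_smooth_neq0 oV Fs.
set U := V `&` _ in oU.
have Xs : smooth U x2.
  by apply: smooth_add => //; apply: smooth_mul => //; apply: smooth_coord.
have oW := open_smooth_neq0 oU Xs; set W := U `&` _ in oW.
have WV : W `<=` V by move=> q [[]].
have noW q : ~ W q.
  apply: (@einstein_contradiction _ W H Y oW) => //.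
  - exact: smooth_sub Hs.
  - exact: smooth_sub Ys.
  - by move=> r /WV/r_free.
  - by move=> r /WV/b0.
  - by move=> r /WV/b1.
  - by exists lambda => r /WV/ein.
  - by move=> r [[]].
  - by move=> r [].
have [x0|xn0] := eqVneq (x2 p) 0; last by case: (noW p).
have Up : U p by [].
have [h h0 hU] := nbhs_plane i_x1 i_x1 (open_nbhs_nbhs (conj oU Up)).
have /= Uq := hU h 0.
case: (noW (p + h *: delta_mx 0 i_x1 + 0 *: delta_mx 0 i_x1)); split.
  by apply: Uq; rewrite lexx ltW.
have p0 : p 0 i_x1 = 0.
  move/eqP: x0; rewrite paddr_eq0 ?sqr_ge0 // !sqrf_eq0.
  by move=> /andP[/eqP ? /eqP].
rewrite /= /x2 !mxE p0 /= mulr1 mulr0 mul0r add0r !addr0.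
by rewrite gt_eqF // ltr_wpDr ?sqr_ge0 // exprn_gt0.
Qed.

End EinsteinRigidityLocal.

(** * Rescalings by a function of u that are flat *)

(** Halves the number of components to be computed. *)
Lemma skew_eq0 (R : realType) (n : nat) (F : 'I_n -> 'I_n -> R) :
  (forall i j, F j i = - F i j) -> (forall i j : 'I_n, (i < j)%N -> F i j = 0) ->
  forall i j, F i j = 0.
Proof.
move=> Fskew F0 i j; have [ij|ji|/val_inj ->] := ltngtP i j; first exact: F0.
  by rewrite Fskew F0 ?oppr0.
by move: (F j j) (Fskew j j) => x; lra.
Qed.

Lemma riemann_skew (R : realType) (n : nat) (g : 'rV[R]_n -> 'M[R]_n) l k i j p :
  riemann g l k j i p = - riemann g l k i j p.
Proof.
rewrite /riemann opprD opprB; congr (_ + _).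
by rewrite -sumrN; apply: eq_bigr => m _; rewrite opprB.
Qed.

Lemma cotton_skew (R : realType) (n : nat) (g : 'rV[R]_n -> 'M[R]_n) a b c p :
  cotton g a c b p = - cotton g a b c p.
Proof. exact: esym (opprB _ _). Qed.

Section FlatRescaling.
Context {R : realType}.
Local Notation E := 'rV[R]_4.

(** With dY proportional to du the Riemann tensor only involves
    Y_uu - Y_u^2 + H_11, H_11 - H_22 and H_12.  The condition on Y says that
    s = exp(- Y) solves s'' = H_11 s. *)
Lemma flat_rescaling (V : set E) (H Y : E -> R) : open V -> smooth V H ->
  smooth V Y -> (forall p, V p -> partial i_r H p = 0) ->
  (forall p, V p -> [/\ partial i_x1 Y p = 0, partial i_x2 Y p = 0 & partial i_r Y p = 0]) ->
  (forall p, V p -> partial i_x2 (partial i_x2 H) p = partial i_x1 (partial i_x1 H) p) ->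
  (forall p, V p -> partial i_x1 (partial i_x2 H) p = 0) ->
  (forall p, V p -> partial i_u (partial i_u Y) p
     = partial i_u Y p ^+ 2 - partial i_x1 (partial i_x1 H) p) ->
  flat_on (rescale Y (brinkmann H)) V.
Proof.
move=> oV Hs Ys r_free Y_u H11 H01 Y22 p Vp l k.
apply: skew_eq0 => [i j|i j ij]; first exact: riemann_skew.
have Z m n : (forall q, V q -> partial n Y q = 0) -> partial m (partial n Y) p = 0.
  by move=> n0; apply: (partialP_on oV Vp n0 (isd_cst _ _ 0)).
have Z' m n : (forall q, V q -> partial n Y q = 0) -> partial n (partial m Y) p = 0.
  by move=> n0; rewrite (partial_comm _ _ oV Ys Vp); exact: Z.
have Y0 q : V q -> partial i_x1 Y q = 0 by case/Y_u.
have Y1 q : V q -> partial i_x2 Y q = 0 by case/Y_u.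
have Y3 q : V q -> partial i_r Y q = 0 by case/Y_u.
have a0 m := Z m _ Y0; have a1 m := Z m _ Y1; have a3 m := Z m _ Y3.
have b0 m := Z' m _ Y0; have b1 m := Z' m _ Y1; have b3 m := Z' m _ Y3.
have C m n := partial_comm m n oV Hs Vp.
have H10 := C i_x2 i_x1; have H20 := C i_u i_x1; have H21 := C i_u i_x2.
have z3 m := partial_partial_r oV r_free m Vp; have z3' m := partial_r_partial oV Hs r_free m Vp.
rewrite (riemannE oV Hs Ys r_free _ _ _ _ Vp) /conf_chr /dconf_chr.
move: (r_free p Vp) (Y0 p Vp) (Y1 p Vp) (Y3 p Vp) (H11 p Vp) (H01 p Vp) (Y22 p Vp).
move: a0 a1 a3 b0 b1 b3 H10 H20 H21 z3 z3'.
move: (@partial R 4) (H p) => {C Z Z' Y0 Y1 Y3 Y22 H11 H01 Y_u r_free Hs Ys oV} P h.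
move=> a0 a1 a3 b0 b1 b3 H10 H20 H21 z3 z3' h3 y0 y1 y3 h11 h01 y22.
move: ij; elim/ord4_ind: i; elim/ord4_ind: j => // _; elim/ord4_ind: l; elim/ord4_ind: k; rewrite /=
  ?a0 ?a1 ?a3 ?b0 ?b1 ?b3 ?y22 ?H10 ?h01 ?h11 ?H20 ?H21 ?z3 ?z3' ?h3 ?y0 ?y1 ?y3; ring.
Qed.

End FlatRescaling.

(** * The rescaling by the distance to the axis is Cotton-flat *)

Section CottonFlatRescaling.
Context {R : realType}.
Local Notation E := 'rV[R]_4.

Variables (V : set E) (H : E -> R).
Hypotheses (oV : open V) (Hs : smooth V H).
Hypothesis r_free : forall p, V p -> partial i_r H p = 0.
Local Notation D i p := (partial i (laplacian H) p).
Hypothesis pde_re : forall p, V p ->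
  p 0 i_x1 * D i_x1 p - p 0 i_x2 * D i_x2 p
    = 2 * (partial i_x1 (partial i_x1 H) p - partial i_x2 (partial i_x2 H) p).
Hypothesis pde_im : forall p, V p ->
  p 0 i_x1 * D i_x2 p + p 0 i_x2 * D i_x1 p = 4 * partial i_x1 (partial i_x2 H) p.

Let t (q : E) := q 0 i_x1 * q 0 i_x1 + q 0 i_x2 * q 0 i_x2.
Hypothesis t_gt0 : forall p, V p -> 0 < t p.

Definition radial_scale (q : E) : R := - ln (q 0 i_x1 * q 0 i_x1 + q 0 i_x2 * q 0 i_x2).
Local Notation Y := radial_scale.
Local Notation g := (rescale Y (brinkmann H)).

Lemma t_smooth : smooth V t.
Proof. by apply: smooth_add => //; apply: smooth_mul => //; apply: smooth_coord. Qed.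

Lemma radial_smooth : smooth V Y.
Proof. by apply: smooth_opp => //; apply: smooth_ln => //; exact: t_smooth. Qed.

Definition dt (i : nat) (q : E) : R :=
  match i with 0%N => 2 * q 0 i_x1 | 1%N => 2 * q 0 i_x2 | _ => 0 end.

Lemma isd_t (i : 'I_4) q : is_derive q (delta_mx 0 i) t (dt i q).
Proof.
apply: (is_derive_eq (isd_add (isd_mul (isd_coord _ _ _) (isd_coord _ _ _))
  (isd_mul (isd_coord _ _ _) (isd_coord _ _ _)))).
by elim/ord4_ind: i => /=; ring.
Qed.

Definition d2t (i j : nat) : R :=
  match i, j with 0%N, 0%N | 1%N, 1%N => 2 | _, _ => 0 end.

Lemma isd_dt (i j : 'I_4) q : is_derive q (delta_mx 0 i) (dt j) (d2t i j).
Proof.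
elim/ord4_ind: j; rewrite /=.
- apply: (is_derive_eq (isd_mul (isd_cst _ _ 2) (isd_coord _ _ _))).
  by elim/ord4_ind: i => /=; ring.
- apply: (is_derive_eq (isd_mul (isd_cst _ _ 2) (isd_coord _ _ _))).
  by elim/ord4_ind: i => /=; ring.
- by apply: (is_derive_eq (isd_cst _ _ 0)); elim/ord4_ind: i.
- by apply: (is_derive_eq (isd_cst _ _ 0)); elim/ord4_ind: i.
Qed.

Lemma isd_tV (i : 'I_4) q : V q ->
  is_derive q (delta_mx 0 i) (fun r => (t r)^-1) (- dt i q * (t q)^-1 * (t q)^-1).
Proof. by move=> Vq; apply: isd_inv (isd_t i q); rewrite gt_eqF // t_gt0. Qed.

Lemma partial_Y i q : V q -> partial i Y q = - ((t q)^-1 * dt i q).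
Proof. by move=> Vq; apply: partialP; apply: isd_opp; apply: isd_ln (isd_t i q); exact: t_gt0. Qed.

Lemma partial2_Y i j q : V q ->
  partial i (partial j Y) q = dt i q * dt j q * (t q)^-1 * (t q)^-1 - d2t i j * (t q)^-1.
Proof.
move=> Vq; rewrite (partialP_on oV Vq (partial_Y j) (isd_opp (isd_mul (isd_tV i Vq) (isd_dt i j q)))).
by ring.
Qed.

(** Components of the Schouten tensor of the rescaled metric; the radial
    function is the one for which the dx^i dx^j components vanish. *)
Definition radial_schouten (a b : nat) (q : E) : R :=
  match a, b with
  | 2%N, 2%N => - 2^-1 * laplacian H q +
    (2 * (q 0 i_x1 * partial i_x1 H q + q 0 i_x2 * partial i_x2 H q) - 4 * H q) * (t q)^-1
  | 2%N, 3%N | 3%N, 2%N => -2 * (t q)^-1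
  | _, _ => 0
  end.

Lemma radial_schoutenE a b q : V q -> schouten g a b q = radial_schouten a b q.
Proof.
move=> Vq; rewrite (schoutenE oV Hs radial_smooth r_free _ _ Vq).
have t0 : t q != 0 by rewrite gt_eqF // t_gt0.
rewrite /conf_hess /grad_norm2 /radial_schouten sum_ord4 !(partial_Y _ Vq) !(partial2_Y _ _ Vq).
move: t0; rewrite /t.
move: (@partial R 4) (laplacian H q) (H q) => P L h.
by elim/ord4_ind: a; elim/ord4_ind: b; rewrite /= /t => t0; field.
Qed.

Definition dradial_schouten (c : 'I_4) (a b : nat) (q : E) : R :=
  match a, b with
  | 2%N, 2%N => - 2^-1 * D c q +
    (2 * (kron c 0 * partial i_x1 H q + q 0 i_x1 * partial c (partial i_x1 H) q
          + (kron c 1 * partial i_x2 H q + q 0 i_x2 * partial c (partial i_x2 H) q))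
     - 4 * partial c H q) * (t q)^-1
    + (2 * (q 0 i_x1 * partial i_x1 H q + q 0 i_x2 * partial i_x2 H q) - 4 * H q)
      * (- dt c q * (t q)^-1 * (t q)^-1)
  | 2%N, 3%N | 3%N, 2%N => -2 * (- dt c q * (t q)^-1 * (t q)^-1)
  | _, _ => 0
  end.

Lemma kronE (i j : 'I_4) : (i == j)%:R = kron i j :> R.
Proof. by elim/ord4_ind: i; elim/ord4_ind: j. Qed.

Lemma isd_radial_schouten (c a b : 'I_4) q : V q ->
  is_derive q (delta_mx 0 c) (radial_schouten a b) (dradial_schouten c a b q).
Proof.
move=> Vq.
have Ls : smooth V (laplacian H) by apply: smooth_add => //; do 2!apply: smooth_partial.
have d23 : is_derive q (delta_mx 0 c) (fun q => -2 * (t q)^-1)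
    (-2 * (- dt c q * (t q)^-1 * (t q)^-1)).
  apply: (is_derive_eq (isd_mul (isd_cst _ _ (-2)) (isd_tV c Vq))).
  by rewrite mul0r add0r.
elim/ord4_ind: a; elim/ord4_ind: b; rewrite /=; try exact: isd_cst; try exact: d23.
apply: (is_derive_eq (isd_add (isd_mul (isd_cst _ _ (- 2^-1)) (smooth_isd c Ls Vq))
  (isd_mul (isd_add
    (isd_mul (isd_cst _ _ 2) (isd_add
      (isd_mul (isd_coord c i_x1 q) (smooth_isd c (smooth_partial i_x1 Hs) Vq))
      (isd_mul (isd_coord c i_x2 q) (smooth_isd c (smooth_partial i_x2 Hs) Vq))))
    (isd_opp (isd_mul (isd_cst _ _ 4) (smooth_isd c Hs Vq)))) (isd_tV c Vq)))).
rewrite !kronE /=.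
move: (@partial R 4) (laplacian H) ((t q)^-1) (dt c q) (kron c 0) (kron c 1) => P L s d k0 k1; ring.
Qed.

Lemma laplacian_r q : V q -> D i_r q = 0.
Proof.
move=> Vq.
have Z i : partial i_r (partial i (partial i H)) q = 0.
  rewrite (partial_comm _ _ oV (smooth_partial i Hs) Vq).
  apply: (partialP_on oV Vq _ (isd_cst _ _ 0)) => r Vr.
  exact: (partial_r_partial oV Hs r_free i Vr).
rewrite (partialP (isd_add (smooth_isd i_r (smooth_partial i_x1 (smooth_partial i_x1 Hs)) Vq)
  (smooth_isd i_r (smooth_partial i_x2 (smooth_partial i_x2 Hs)) Vq))).
by rewrite !Z addr0.
Qed.

(** Solving the two PDEs for dL turns each component into a
    rational identity in the jets of H. *)
Lemma cotton_radial_rescaling : cotton_flat_on g V.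
Proof.
move=> p Vp a; apply: skew_eq0 => [b c|b c bc]; first exact: cotton_skew.
rewrite /cotton /nabla2 -!partialE.
rewrite !(partialP_on oV Vp (fun q Vq => radial_schoutenE _ _ Vq) (isd_radial_schouten _ _ _ Vp)).
under eq_bigr => d _ do
  rewrite !(christoffelE Hs radial_smooth r_free _ _ _ Vp) !(radial_schoutenE _ _ Vp).
under [X in _ - (_ - X)]eq_bigr => d _ do
  rewrite !(christoffelE Hs radial_smooth r_free _ _ _ Vp) !(radial_schoutenE _ _ Vp).
have t0 : t p != 0 by rewrite gt_eqF // t_gt0.
(* The two PDEs, solved for the differential of L. *)
have D0 : D i_x1 p = (2 * (partial i_x1 (partial i_x1 H) p - partial i_x2 (partial i_x2 H) p) * p 0 i_x1
   + 4 * partial i_x1 (partial i_x2 H) p * p 0 i_x2) / t p.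
  by rewrite -pde_re // -pde_im // /t; move: t0; rewrite /t => t0; field.
have D1 : D i_x2 p = (4 * partial i_x1 (partial i_x2 H) p * p 0 i_x1
   - 2 * (partial i_x1 (partial i_x1 H) p - partial i_x2 (partial i_x2 H) p) * p 0 i_x2) / t p.
  by rewrite -pde_re // -pde_im // /t; move: t0; rewrite /t => t0; field.
have D3 := laplacian_r Vp.
have C m n := partial_comm m n oV Hs Vp.
have H10 := C i_x2 i_x1; have H20 := C i_u i_x1; have H21 := C i_u i_x2.
have z3 m := partial_partial_r oV r_free m Vp; have z3' m := partial_r_partial oV Hs r_free m Vp.
rewrite !sum_ord4 /conf_chr /dradial_schouten /radial_schouten.
rewrite /raise !(partial_Y _ Vp).
have lE : laplacian H p = partial i_x1 (partial i_x1 H) p + partial i_x2 (partial i_x2 H) p by [].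
move: (r_free Vp) t0 D0 D1 D3 H10 H20 H21 z3 z3' lE {C}; rewrite /t.
move: (@partial R 4) (laplacian H) (H p) => P L h h3 t0 D0 D1 D3 H10 H20 H21 z3 z3' lE.
move: bc; elim/ord4_ind: b; elim/ord4_ind: c => // _; elim/ord4_ind: a; rewrite /=
  ?D0 ?D1 ?D3 ?lE ?H10 ?H20 ?H21 ?z3 ?z3' ?h3 /t; by field.
Qed.

End CottonFlatRescaling.

(** * Positive solutions of a linear second order equation *)

Section LinearODE.
Context {R : realType}.
Variables (a b : R).
Hypothesis ab : a < b.

(** Extends coefficients from the interval [a, b] to the line, so that the
    iteration takes place among functions that are continuous everywhere. *)
Definition clamp (x : R) : R := Num.max a (Num.min b x).

Lemma clamp_itv x : a <= clamp x <= b.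
Proof. by rewrite /clamp le_max lexx /= ge_max ge_min lexx (ltW ab). Qed.

Lemma clamp_id x : a <= x <= b -> clamp x = x.
Proof.
by move=> /andP[ax xb]; rewrite /clamp (min_idPr _) //; exact/max_idPr.
Qed.

Lemma clampK x : clamp (clamp x) = clamp x.
Proof. by rewrite clamp_id // clamp_itv. Qed.

Lemma clamp_continuous : continuous clamp.
Proof.
move=> x; have cmin : {for x, continuous (fun y : R => Num.min b y)}.
  exact: (continuous_min (@cst_continuous _ _ b x) (fun _ => id)).
exact: (continuous_max (@cst_continuous _ _ a x) cmin).
Qed.

(** The primitive is an integral on [a, b] and constant outside. *)
Lemma primitive_exists (f : R -> R) : continuous f ->
  exists G : R -> R, [/\ continuous G, forall x, G (clamp x) = G x, G a = 0 &
    forall x, a < x < b -> is_derive x 1 G (f x)].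
Proof.
move=> fc.
pose F0 (x : R) := (\int[lebesgue_measure]_(t in [set` Interval (BLeft (a - 1)) (BRight x)]) f t)%R.
have F0d x : a <= x <= b -> is_derive x 1 F0 (f x).
  move=> /andP[ax xb].
  have xu : x < b + 1 by rewrite (le_lt_trans xb) // ltrDl.
  have fi : lebesgue_measure.-integrable [set` Interval (BLeft (a - 1)) (BRight (b + 1))] (EFin \o f).
    apply: continuous_compact_integrable; first exact: segment_compact.
    by apply: continuous_subspaceT => y; exact: fc.
  have lx : a - 1 < x by rewrite (lt_le_trans _ ax) // gtrBl.
  have [Fd FE] := continuous_FTC1_closed xu fi lx (fc x).
  by apply: DeriveDef; [exact: Fd|rewrite -derive1E; exact: FE].
pose G x := F0 (clamp x) - F0 a.
have aa : a <= a <= b by rewrite lexx ltW.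
exists G; split.
- move=> x; have H := F0d _ (clamp_itv x).
  have Fc : {for clamp x, continuous F0}.
    by apply: differentiable_continuous; apply/derivable1_diffP; exact: ex_derive.
  have Gc := continuous_comp (@clamp_continuous x) Fc.
  exact: (continuousB Gc (@cst_continuous _ _ (F0 a) x)).
- by move=> x; rewrite /G clampK.
- by rewrite /G clamp_id // subrr.
- move=> x /andP[ax xb].
  have nx : \near x, F0 x - F0 a = G x.
    near=> y; rewrite /G clamp_id //; apply/andP; split; apply: ltW; near: y.
      exact: lt_nbhsr.
    exact: lt_nbhsl.
  apply: near_eq_is_derive nx _.
  have H : is_derive x 1 F0 (f x) by apply: F0d; rewrite !ltW.
  by apply: is_derive_eq; rewrite subr0.
Unshelve. all: by end_near. Qed.

(** Taking primitives multiplies the uniform norm by at most the length of the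
    interval; the difference of two primitives is estimated in this way. *)
Lemma primitive_bound (h dh : R -> R) (C : R) : continuous h ->
  (forall x, h (clamp x) = h x) -> h a = 0 ->
  (forall x, a < x < b -> is_derive x 1 h (dh x)) ->
  (forall x, `|dh x| <= C) -> forall x, `|h x| <= (b - a) * C.
Proof.
move=> hc hK ha hd hC x; rewrite -hK.
have C0 : 0 <= C := le_trans (normr_ge0 _) (hC a).
have /andP[] := clamp_itv x; move: (clamp x) => y ay yb.
move: ay; rewrite le_eqVlt => /predU1P[<-|ay].
  by rewrite ha normr0 mulr_ge0 // subr_ge0 ltW.
have hd' z : z \in `]a, y[ -> is_derive z 1 h (dh z).
  rewrite in_itv /= => /andP[az zy]; apply: hd.
  by rewrite az (lt_le_trans zy yb).
have [//|c _] := MVT ay hd'; first by apply: continuous_subspaceT => z; exact: hc.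
have ya : 0 <= y - a by rewrite subr_ge0 ltW.
rewrite ha subr0 => ->; rewrite normrM (ger0_norm ya) [leRHS]mulrC.
by apply: ler_pM => //; rewrite lerD2r.
Qed.

Variables (q : R -> R) (M : R).
Hypothesis qc : continuous q.
Hypothesis qM : forall x, `|q x| <= M.
Hypothesis Mab : M * (b - a) ^+ 2 <= 4^-1.

Lemma continuous_mulq (s : R -> R) : continuous s -> continuous (fun x => q x * s x).
Proof. by move=> sc x; exact: (continuousM (@qc x) (sc x)). Qed.

(** Picard iteration for the integral operator T s = 1 + (double primitive of
    q s), a contraction with factor 1/4 on a short interval; its fixed point
    stays within 1/2 of the constant 1, hence is positive. *)
Lemma linear_ode : exists s v : R -> R,
  [/\ continuous s, continuous v,
      forall x, a < x < b -> is_derive x 1 s (v x),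
      forall x, a < x < b -> is_derive x 1 v (q x * s x) &
      forall x, 0 < s x].
Proof.
have /choice[G GP] : forall f : R -> R, exists G : R -> R, continuous f ->
    [/\ continuous G, forall x, G (clamp x) = G x, G a = 0 &
        forall x, a < x < b -> is_derive x 1 G (f x)].
  move=> f; case: (pselect (continuous f)) => [/primitive_exists[G GP]|nf].
    by exists G.
  by exists f.
have Gc (f : R -> R) : continuous f -> continuous (G f) by move=> /GP[].
have GL (f f' : R -> R) C : continuous f -> continuous f' ->
    (forall x : R, `|f x - f' x| <= C) -> forall x, `|G f x - G f' x| <= (b - a) * C.
  move=> fc fc' ff'; have [g1 g2 g3 g4] := GP f fc; have [k1 k2 k3 k4] := GP f' fc'.
  apply: (@primitive_bound (fun x => G f x - G f' x) (fun x => f x - f' x)) => //.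
  - by move=> x; exact: (continuousB (g1 x) (k1 x)).
  - by move=> x; rewrite g2 k2.
  - by rewrite g3 k3 subrr.
  - by move=> x xab; have H1 := g4 x xab; have H2 := k4 x xab; exact: is_deriveB.
pose T (s : R -> R) x := 1 + G (G (fun x => q x * s x)) x.
have Tc (s : R -> R) : continuous s -> continuous (T s).
  move=> sc x; have c1 : {for x, continuous (fun=> 1 : R)} by exact: cst_continuous.
  have g1 : {for x, continuous (G (G (fun y => q y * s y)))}.
    exact: (Gc _ (Gc _ (continuous_mulq sc))).
  exact: (continuousD c1 g1).
(* Two primitives cost (b - a)^2, and the coefficient q costs M. *)
have TL (s s' : R -> R) C : continuous s -> continuous s' ->
    (forall x : R, `|s x - s' x| <= C) -> forall x, `|T s x - T s' x| <= 4^-1 * C.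
  move=> sc sc' ss' x; rewrite /T opprD addrACA subrr add0r.
  have C0 : 0 <= C := le_trans (normr_ge0 _) (ss' a).
  have h1 y : `|q y * s y - q y * s' y| <= M * C.
    by rewrite -mulrBr normrM ler_pM.
  have h2 := GL _ _ _ (continuous_mulq sc) (continuous_mulq sc') h1.
  have h3 := GL _ _ _ (Gc _ (continuous_mulq sc)) (Gc _ (continuous_mulq sc')) h2 x.
  apply: (le_trans h3).
  rewrite (_ : (b - a) * ((b - a) * (M * C)) = M * (b - a) ^+ 2 * C); last by ring.
  exact: ler_wpM2r.
pose S := fix S k : R -> R := if k is k'.+1 then T (S k') else fun=> 1.
have Sc k : continuous (S k).
  by elim: k => [|k IH]; [exact: cst_continuous|exact: Tc].
pose e k : R := 4^-1 ^+ k.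
have eS k : e k.+1 = 4^-1 * e k by rewrite /e exprS.
have e0 k : 0 < e k by rewrite exprn_gt0 // invr_gt0.
have T1 x : `|S 1%N x - S 0%N x| <= e 1%N.
  have G0 (f : R -> R) : continuous f -> (forall y, f y = 0) -> forall y, G f y = 0.
    move=> fc f0 y; have [g1 g2 g3 g4] := GP f fc; apply/eqP; rewrite -normr_le0.
    have := @primitive_bound (G f) f 0 g1 g2 g3 g4 _ y.
    by rewrite mulr0; apply => z; rewrite f0 normr0.
  have z0 : continuous (fun x : R => q x * 0) by apply: continuous_mulq; exact: cst_continuous.
  have z1 := G0 _ z0 (fun y => mulr0 _).
  have z2 := G0 _ (Gc _ z0) z1.
  have z3 (y : R) : `|(1 : R) - 0| <= 1 by rewrite subr0 normr1.
  have := TL (fun=> 1) (fun=> 0) 1 (@cst_continuous _ _ _) (@cst_continuous _ _ _) z3 x.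
  by rewrite /= {2}/T z2 addr0 mulr1 /e expr1.
have Sd k x : `|S k.+1 x - S k x| <= e k.+1.
  elim: k x => [|k IH] x; first exact: T1.
  rewrite eS; exact: (TL _ _ _ (Sc k.+1) (Sc k) IH).
have SD k n x : `|S (k + n)%N x - S k x| <= 3^-1 * (e k - e (k + n)%N).
  elim: n => [|n IH]; first by rewrite addn0 !subrr normr0 mulr0.
  rewrite addnS; apply: (le_trans (ler_distD (S (k + n)%N x) _ _)).
  have := Sd (k + n)%N x; rewrite eS => h.
  by apply: (le_trans (lerD h IH)); lra.
have e_cvg : e n @[n --> \oo] --> (0 : R).
  by apply: cvg_expr; rewrite ger0_norm ?invr_ge0 // invf_lt1 // ltr1n.
have e_small (d : R) : 0 < d -> exists k, e k < d.
  move=> d0; have /cvgrPdist_lt /(_ d d0) := e_cvg.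
  case=> k _ /(_ k (leqnn k)) /=; rewrite sub0r normrN gtr0_norm //.
  by exists k.
have cS x : cvgn (fun k => S k x).
  apply/cauchy_cvgP; apply: cauchy_exP => d d0.
  have [k ek] := e_small d d0.
  exists (S k x); exists k => // n /= kn.
  rewrite -ball_normE /= distrC -(subnKC kn).
  apply: le_lt_trans (SD _ _ _) _; apply: le_lt_trans ek.
  have := e0 k; have := e0 (k + (n - k))%N; lra.
pose s x := limn (fun k => S k x).
have sS k x : `|s x - S k x| <= e k.
  have c1 : (fun n => `|S n x - S k x|) @ \oo --> `|s x - S k x|.
    by apply: cvg_norm; apply: cvgB; [exact: cS|exact: cvg_cst].
  rewrite -(cvg_lim _ c1) //; apply: limr_le; first by apply/cvg_ex; eexists; exact: c1.
  exists k => // n /= kn; rewrite -(subnKC kn).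
  apply: le_trans (SD _ _ _) _.
  have := e0 k; have := e0 (k + (n - k))%N; lra.
have sc : continuous s.
  move=> x; apply/cvgrPdist_lt => d d0.
  have d3 : 0 < d / 3 by rewrite divr_gt0.
  have [k ek] := e_small _ d3.
  have /cvgrPdist_lt /(_ _ d3) := Sc k x.
  apply: filterS => y h.
  have h1 := sS k x; have h2 := sS k y; rewrite distrC in h2.
  have := le_lt_trans (ler_distD (S k x) (s x) (s y)); apply.
  have := ler_distD (S k y) (S k x) (s y) => h3.
  apply: (le_lt_trans (lerD h1 h3)).
  by apply: (le_lt_trans (lerD (lexx _) (lerD (lexx _) h2))); lra.
have Ts x : T s x = s x.
  apply/eqP; rewrite -subr_eq0 -normr_le0; apply/ler_addgt0Pl => d d0; rewrite addr0.
  have [k ek] := e_small d d0.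
  have h1 := TL _ _ _ sc (Sc k) (sS k) x.
  have h2 := sS k.+1 x; rewrite distrC eS in h2.
  apply: (le_trans (ler_distD (S k.+1 x) _ _)).
  apply: (le_trans (lerD h1 h2)).
  have := e0 k; lra.
exists s, (G (fun x => q x * s x)); split => //.
- exact: (Gc _ (continuous_mulq sc)).
- move=> x xab.
  have [_ _ _ g4] := GP _ (Gc _ (continuous_mulq sc)).
  have H := g4 x xab.
  have D : is_derive x 1 (T s) (0 + G (fun x => q x * s x) x).
    exact: (isd_add (isd_cst x 1 1) H).
  by move: D; rewrite add0r (_ : T s = s) //; exact/funext.
- by move=> x xab; have [_ _ _] := GP _ (continuous_mulq sc); apply.
- move=> x.
  have h : `|s x - 1| <= 2^-1.
    have := sS 1%N x; have := T1 x; rewrite /= => h1 h2.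
    apply: (le_trans (ler_distD (S 1%N x) _ _)).
    apply: (le_trans (lerD h2 h1)); rewrite /e expr1; lra.
  by move: h; rewrite ler_norml => /andP[]; lra.
Qed.

End LinearODE.

(** * Local flatness *)

Section LocalFlatness.
Context {R : realType}.
Local Notation E := 'rV[R]_4.

Lemma ball_slice (p q : E) (d s t : R) (i : 'I_4) :
  ball p d q -> ball p d (q + t *: delta_mx 0 i) -> 0 <= s <= t ->
  ball p d (q + s *: delta_mx 0 i).
Proof.
move=> [d0 bq] [_ bqt] /andP[s0 st]; split=> // k j.
have := bq k j; have := bqt k j.
rewrite -!ball_normE /= !mxE; case: (_ && _); rewrite ?mulr0 ?addr0 // !mulr1.
by rewrite !ltr_norml => /andP[? ?] /andP[? ?]; apply/andP; split; lra.
Qed.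

(** A vanishing partial derivative makes a function constant along segments;
    balls of row vectors are boxes, so that they contain these segments. *)
Lemma const_slice (p q : E) (d t : R) (i : 'I_4) (f : E -> R) :
  smooth (ball p d) f -> (forall r, ball p d r -> partial i f r = 0) ->
  ball p d q -> ball p d (q + t *: delta_mx 0 i) ->
  f (q + t *: delta_mx 0 i) = f q.
Proof.
move=> fs f0.
wlog t0 : q t / 0 < t => [wl|].
  have [t0|t0|->] := ltgtP t 0; last by rewrite scale0r addr0.
    move=> bq bqt; have tN : 0 < - t by rewrite oppr_gt0.
    have qE : q = q + t *: delta_mx 0 i + (- t) *: delta_mx 0 i.
      by rewrite scaleNr addrK.
    by rewrite {2}qE [RHS]wl // -qE.
  exact: wl.
move=> bq bqt.
have bs s : 0 <= s <= t -> ball p d (q + s *: delta_mx 0 i) by exact: ball_slice.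
have [s st|c ct] := @MVT_slice R 4 f i q t t0.
  exact: @ex_derive _ _ _ _ _ _ _ (smooth_isd i fs (bs s st)).
by rewrite f0 ?mul0r; [move/eqP; rewrite subr_eq0 => /eqP|exact: bs].
Qed.

(** The hypotheses make H_11 a function of u alone on a box around p, hence
    the coefficient of a linear equation whose positive solution provides the
    conformal factor. *)
Lemma locally_flat (M : set E) (H : E -> R) : open M -> smooth M H ->
  (forall p, M p -> partial i_r H p = 0) ->
  (forall p, M p -> partial i_x2 (partial i_x2 H) p = partial i_x1 (partial i_x1 H) p) ->
  (forall p, M p -> partial i_x1 (partial i_x2 H) p = 0) ->
  (forall p, M p -> partial i_x1 (laplacian H) p = 0 /\ partial i_x2 (laplacian H) p = 0) ->
  locally_conformally flat_on M (brinkmann H).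
Proof.
move=> oM Hs r_free H11 H01 D0 p Mp.
pose f := partial i_x1 (partial i_x1 H).
have fs : smooth M f by do 2!apply: smooth_partial.
have f_const i r : i != i_u -> M r -> partial i f r = 0.
  have LE q : M q -> laplacian H q = 2 * f q.
    by move=> Mq; rewrite /laplacian H11 // -/f; ring.
  have half j q : M q -> partial j (laplacian H) q = 2 * partial j f q.
    move=> Mq; apply: (partialP_on oM Mq LE).
    by apply: (is_derive_eq (isd_mul (isd_cst _ _ 2) (smooth_isd j fs Mq))); rewrite mul0r add0r.
  move=> i2 Mr; suff : 2 * partial i f r = 0.
    by move/eqP; rewrite mulf_eq0 pnatr_eq0 => /eqP.
  rewrite -half //; move: i2; elim/ord4_ind: i => // _; [exact: (D0 r Mr).1|exact: (D0 r Mr).2|].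
  exact: laplacian_r oM Hs r_free r Mr.
pose K := `|f p| + 1.
have K1 : 1 <= K by rewrite lerDr.
have K0 : 0 < K by exact: lt_le_trans ltr01 K1.
have : nbhs p (M `&` [set q | `|f q| <= K]).
  apply: filterI; first exact: open_nbhs_nbhs.
  have /cvgrPdist_lt /(_ 1 ltr01) := smooth_cont fs Mp.
  apply: filterS => q h /=; rewrite /K.
  have := ler_distD (f p) (f q) 0; rewrite !subr0 distrC => h'.
  by apply: (le_trans h'); rewrite addrC lerD2l ltW // distrC.
move=> /nbhs_ballP[e /= e0 eM].
(* So small that an interval of length 2 d meets the hypothesis of the linear
   equation, K (2 d)^2 <= 1/4. *)
pose d := Num.min (e / 2) (4^-1 / K).
have d0 : 0 < d by rewrite lt_min !divr_gt0 // invr_gt0.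
have de : d < e.
  by rewrite gt_min; apply/orP; left; rewrite ltr_pdivrMr //; lra.
have dK : d * K <= 4^-1.
  by rewrite -ler_pdivlMr // ge_min lexx orbT.
pose V : set E := ball p d.
have oV : open V by exact: ball_open.
have Ve : V `<=` ball p e by apply: le_ball; exact: ltW.
have VM : V `<=` M by move=> q /Ve/eM[].
have Vp : V p by exact: ballxx.
pose u0 := p 0 i_u; pose a := u0 - d; pose b := u0 + d.
have ab : a < b by rewrite /a /b; lra.
pose c u : E := p + (u - u0) *: delta_mx 0 i_u.
have cM u : a <= u <= b -> ball p e (c u).
  rewrite /a /b => /andP[au ub]; split=> // k j; rewrite -ball_normE /= !mxE.
  case: (_ && _); rewrite ?mulr0 ?mulr1 opprD addrA subrr add0r ?oppr0 ?normr0 //.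
  by rewrite normrN ltr_norml; apply/andP; split; lra.
have c_cont : continuous c.
  move=> u; have c0 : {for u, continuous (fun y : R => y)} by exact: cvg_id.
  have c1 := continuousB c0 (@cst_continuous _ _ u0 u).
  have c2 := continuous_comp c1 (@scalel_continuous R E (delta_mx 0 i_u) _).
  by rewrite /c; exact: (continuousD (@cst_continuous _ _ p u) c2).
pose q (u : R) := f (c (clamp a b u)).
have q_cont : continuous q.
  move=> u; have Mc : M (c (clamp a b u)) by case: (eM _ (cM _ (clamp_itv ab u))).
  have c1 := continuous_comp (@clamp_continuous R a b u) (c_cont (clamp a b u)).
  exact: (continuous_comp c1 (smooth_cont fs Mc)).
have qK u : `|q u| <= K by case: (eM _ (cM _ (clamp_itv ab u))).
have Kab : K * (b - a) ^+ 2 <= 4^-1.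
  have -> : K * (b - a) ^+ 2 = 4 * (d * K) * d by rewrite /a /b; ring.
  have d4 : d <= 4^-1.
    by apply: le_trans dK; rewrite ler_peMr // ltW.
  have dK0 : 0 <= d * K by rewrite mulr_ge0 // ltW.
  have : 4 * (d * K) * d <= 4 * 4^-1 * 4^-1.
    by apply: ler_pM => //; [rewrite mulr_ge0|exact: ltW|rewrite ler_pM2l].
  by move/le_trans; apply; lra.
have [s [v [sc vc sd vd s0]]] := linear_ode ab q_cont qK Kab.
have Vu r : V r -> a < r 0 i_u < b.
  move=> [_ /(_ 0 i_u)]; rewrite -ball_normE /= ltr_norml -/u0 /a /b => /andP[? ?].
  by apply/andP; split; lra.
(* Moving the coordinates x1, x2 and r to those of p does not change f. *)
have fV r : V r -> f r = q (r 0 i_u).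
  move=> Vr; have /andP[/ltW ar /ltW rb] := Vu r Vr.
  rewrite /q clamp_id ?ar //.
  have fsV : smooth (ball p d) f := smooth_sub VM fs.
  have step i r' t : i != i_u -> V r' -> V (r' + t *: delta_mx 0 i) ->
      f (r' + t *: delta_mx 0 i) = f r'.
    by move=> i2; apply: const_slice => // z Vz; apply: f_const => //; exact: VM.
  have mv i r' : V r' -> V (r' + (p 0 i - r' 0 i) *: delta_mx 0 i).
    move=> [_ Vr']; split=> // k j; have := Vr' k j; rewrite -!ball_normE /= !mxE (ord1 k) eqxx /=.
    by case: eqP => [->|_]; rewrite ?mulr0 ?addr0 // mulr1 addrCA subrr addr0 subrr normr0.
  pose r1 := r + (p 0 i_x1 - r 0 i_x1) *: delta_mx 0 i_x1.
  pose r2 := r1 + (p 0 i_x2 - r1 0 i_x2) *: delta_mx 0 i_x2.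
  pose r3 := r2 + (p 0 i_r - r2 0 i_r) *: delta_mx 0 i_r.
  have V1 : V r1 by exact: mv.
  have V2 : V r2 by exact: mv.
  have V3 : V r3 by exact: mv.
  have -> : c (r 0 i_u) = r3.
    apply/rowP => j; rewrite /r3 /r2 /r1 /c /u0 !mxE.
    by elim/ord4_ind: j; rewrite /=; ring.
  by rewrite /r3 step // /r2 step // /r1 step.
pose S (r : E) := s (r 0 i_u); pose W (r : E) := v (r 0 i_u).
have isS i r : V r -> is_derive r (delta_mx 0 i) S ((i == i_u)%:R * W r).
  move=> Vr; rewrite mulrC.
  exact: (isd_comp (sd _ (Vu r Vr)) (isd_coord i i_u r)).
have isW i r : V r -> is_derive r (delta_mx 0 i) W ((i == i_u)%:R * (f r * S r)).
  move=> Vr; rewrite mulrC fV //.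
  exact: (isd_comp (vd _ (Vu r Vr)) (isd_coord i i_u r)).
have cS r : {for r, continuous S}.
  exact: (continuous_comp (@coord_continuous _ _ _ _ _ r) (sc _)).
have cW r : {for r, continuous W}.
  exact: (continuous_comp (@coord_continuous _ _ _ _ _ r) (vc _)).
(* Bootstrap: the derivatives of S and W are S and W times smooth functions. *)
have SW k : Ck k V S /\ Ck k V W.
  elim: k => [|k [IS IW]]; first by split; split.
  split.
    apply: (Ck_intro oV (fun r _ => cS r) (fun r i => isS i r)) => i.
    by apply: Ck_mul => //; exact: Ck_cst.
  apply: (Ck_intro oV (fun r _ => cW r) (fun r i => isW i r)) => i.
  apply: Ck_mul => //; first exact: Ck_cst.
  by apply: Ck_mul => //; exact: Ck_sub VM (fs k).
have Ss : smooth V S by move=> k; case: (SW k).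
have Ws : smooth V W by move=> k; case: (SW k).
pose Y r := - ln (S r).
have Ys : smooth V Y by apply: smooth_opp => //; apply: smooth_ln => // r _; exact: s0.
have S0 r : S r != 0 by rewrite gt_eqF // s0.
have pY i r : V r -> partial i Y r = - ((S r)^-1 * ((i == i_u)%:R * W r)).
  by move=> Vr; apply: partialP; apply: isd_opp; apply: isd_ln (isS i r Vr); exact: s0.
exists V; split => //; exists Y; split => //.
apply: flat_rescaling => //.
- exact: smooth_sub Hs.
- by move=> r /VM/r_free.
- by move=> r Vr; rewrite !pY //= !mul0r mulr0 oppr0.
- by move=> r /VM/H11.
- by move=> r /VM/H01.
move=> r Vr; rewrite (partialP_on oV Vr (pY i_u) (isd_opp (isd_mul (isd_inv (S0 r) (isS i_u r Vr))
  (isd_mul (isd_cst _ _ _) (isW i_u r Vr))))).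
rewrite pY // -/f eqxx /=; have := S0 r; move: (S r) (W r) (f r) => S' W' f' S0'.
by field.
Qed.

End LocalFlatness.

(** * Limits in the complex plane *)

Section ComplexLimits.
Context {R : realType}.
Local Notation C := R[i].
Local Notation normc := (@Normc.normc R).
Implicit Types (z w k : C) (e : R).

Lemma normrCE z : `|z| = (normc z)%:C%C.
Proof. by rewrite normc_def; case: z. Qed.

Lemma normC_lt z e : (`|z| < e%:C%C) = (normc z < e).
Proof. by rewrite normrCE ltcR. Qed.

Lemma Re_le_normc z : `|complex.Re z| <= normc z.
Proof.
by have := normc_ge_Re z; rewrite normrCE lecR.
Qed.

Lemma Im_le_normc z : `|complex.Im z| <= normc z.
Proof.
have i1 : normc 'i%C = 1 by rewrite /= expr0n expr1n add0r sqrtr1.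
have := Re_le_normc (z * 'i%C).
by rewrite Normc.normcM i1 mulr1 ReiNIm normrN.
Qed.

Lemma normc_le_add z : normc z <= `|complex.Re z| + `|complex.Im z|.
Proof.
case: z => a b /=.
rewrite -[leRHS]ger0_norm ?addr_ge0 // -sqrtr_sqr ler_wsqrtr //.
by rewrite sqrrD !real_normK ?num_real // lerD2r lerDl mulrn_wge0 // mulr_ge0.
Qed.

Lemma posC (e : C) : 0 < e -> e = (complex.Re e)%:C%C /\ 0 < complex.Re e.
Proof. by case: e => a b; rewrite ltcE /= => /andP[/eqP -> ?]. Qed.

(** The metric structure of R[i] takes its radii in R[i]; this restates
    convergence with real radii. *)
Lemma cvgC_normP (T : Type) (F : set_system T) (FF : Filter F) (f : T -> C^o) (l : C^o) :
  f @ F --> l <-> (forall e, 0 < e -> \forall x \near F, normc (l - f x) < e).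
Proof.
split=> [fl e e0|fl].
  have /cvgrPdist_lt /(_ e%:C%C) := fl; rewrite ltcR => /(_ e0).
  by apply: filterS => x; rewrite normC_lt.
apply/cvgrPdist_lt => e /posC[-> e0].
by apply: filterS (fl _ e0) => x; rewrite normC_lt.
Qed.

Lemma dnbhsC (P : set C) : (\forall h \near (0 : C^o)^', P h) <->
  exists2 d : R, 0 < d & forall h, h != 0 -> normc h < d -> P h.
Proof.
split.
  move=> [d /= d0 dP]; have [dE d0'] := posC d0.
  exists (complex.Re d) => // h h0 hd; apply: dP => //=.
  by rewrite sub0r normrN dE normC_lt.
move=> [d d0 dP]; exists d%:C%C; first by rewrite /= ltcR.
by move=> h /=; rewrite sub0r normrN normC_lt => hd h0; exact: dP.
Qed.

Lemma derive1_complex (f : C^o -> C^o) (z l : C) :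
  (forall e, 0 < e -> exists2 d : R, 0 < d &
     forall k, k != 0 -> normc k < d -> normc (l - k^-1 * (f (k + z) - f z)) < e) ->
  derive1 f z = l.
Proof.
move=> H; rewrite /derive1; apply: cvg_lim => //.
by apply/cvgC_normP => e /H /dnbhsC.
Qed.

(** The epsilon-delta form of complex differentiability at a point. *)
Lemma derivable_complex (f : C^o -> C^o) (z : C) : derivable f z 1 ->
  forall e, 0 < e -> exists2 d : R, 0 < d &
     forall k, k != 0 -> normc k < d ->
       normc (derive1 f z - k^-1 * (f (k + z) - f z)) < e.
Proof.
move=> fd e e0; apply/dnbhsC.
have fl : (fun k : C^o => k^-1 *: (f (k + z) - f z)) @ (0 : C^o)^' --> derive1 f z.
  have -> : (fun k : C^o => k^-1 *: (f (k + z) - f z)) =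
      (fun h : C^o => h^-1 *: ((f \o shift z) (h *: (1 : C^o)) - f z)).
    by apply/funext => h /=; rewrite [h *: _]mulr1.
  by rewrite derive1E; exact: fd.
by have /cvgC_normP /(_ e e0) := fl.
Qed.

End ComplexLimits.

(** * Real partial derivatives of a holomorphic function *)

Section HolomorphicProfile.
Context {R : realType}.
Local Notation C := R[i].
Local Notation E := 'rV[R]_4.
Local Notation normc := (@Normc.normc R).
Local Notation sqrt2 := (Num.sqrt 2 : R).

Lemma sqrt2_gt0 : 0 < sqrt2. Proof. by rewrite sqrtr_gt0. Qed.

Lemma sqrt2_sqr : sqrt2 * sqrt2 = 2. Proof. by rewrite -expr2 sqr_sqrtr. Qed.

Lemma sqrt2_ge1 : 1 <= sqrt2.
Proof. by rewrite -[leLHS]sqrtr1 ler_wsqrtr // ler1n. Qed.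

Lemma zcE (p : E) : zc p = Complex (p 0 i_x1 / sqrt2) (p 0 i_x2 / sqrt2).
Proof. by rewrite /zc; congr (Complex (p _ _ / _) (p _ _ / _)); exact: val_inj. Qed.

Lemma ucE (p : E) : uc p = p 0 i_u.
Proof. by rewrite /uc; congr (p _ _); exact: val_inj. Qed.

Lemma normr_div_sqrt2 (x : R) : `|x / sqrt2| <= `|x|.
Proof.
rewrite normrM ler_piMr // ger0_norm ?invr_ge0 ?sqrtr_ge0 //.
by rewrite invf_le1 ?sqrt2_gt0 ?sqrt2_ge1.
Qed.

Lemma zc_continuous : continuous (zc : E -> C^o).
Proof.
move=> p; suff N : forall e : R, 0 < e -> \forall q \near p, normc (zc p - zc q) < e.
  exact: (proj2 (@cvgC_normP R E (nbhs p) _ zc (zc p)) N).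
move=> e e0.
have e2 : 0 < e / 2 by rewrite divr_gt0.
have /cvgrPdist_lt /(_ _ e2) c0 := @coord_continuous R 1 4 0 i_x1 p.
have /cvgrPdist_lt /(_ _ e2) c1 := @coord_continuous R 1 4 0 i_x2 p.
near=> q; rewrite !zcE; apply: le_lt_trans (normc_le_add _) _ => /=.
rewrite [ltRHS]splitr -!mulrBl.
apply: ltrD; apply: le_lt_trans (normr_div_sqrt2 _) _; near: q; [exact: c0|exact: c1].
Unshelve. all: by end_near. Qed.

(** The chart is the preimage of Omega under the continuous map (z, u). *)
Lemma chart_open (Omega : set (C * R)) : open (Omega : set (C^o * R)) ->
  open (chart Omega).
Proof.
move=> oO; rewrite openE => p Mp.
have c : (fun q : E => (zc q, uc q) : C^o * R) @ p --> ((zc p, uc p) : C^o * R).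
  exact: (cvg_pair (@zc_continuous p) (@coord_continuous R 1 4 0 2 p)).
exact: c (open_nbhs_nbhs (conj oO Mp)).
Qed.

Lemma zc_shift0 (p : E) h : zc (h *: delta_mx 0 i_x1 + p) = (h / sqrt2)%:C%C * 1 + zc p.
Proof.
rewrite !zcE; apply/eqP; rewrite eq_complex /= !mxE /=.
by apply/andP; split; apply/eqP; ring.
Qed.

Lemma zc_shift1 (p : E) h : zc (h *: delta_mx 0 i_x2 + p) = (h / sqrt2)%:C%C * 'i%C + zc p.
Proof.
rewrite !zcE; apply/eqP; rewrite eq_complex /= !mxE /=.
by apply/andP; split; apply/eqP; ring.
Qed.

Lemma uc_shift (p : E) i h : i != i_u -> uc (h *: delta_mx 0 i + p) = uc p.
Proof. by rewrite !ucE !mxE eqxx /= eq_sym => /negbTE ->; rewrite mulr0 add0r. Qed.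

(** Restricts the complex difference quotient to the real line through z in the
    direction w, where w = 1 for x1 and w = i for x2; phi is the real or the
    imaginary part.  The factor sqrt 2 comes from z = (x1 + i x2) / sqrt 2. *)
Lemma holomorphic_partial (phi : C -> R) (alpha : C -> R -> C) (p : E) i (w : C) :
  (forall z, `|phi z| <= normc z) ->
  (forall z z', phi (z - z') = phi z - phi z') ->
  (forall (x : R) z, phi (x%:C%C * z) = x * phi z) ->
  normc w = 1 -> i != i_u ->
  (forall h, zc (h *: delta_mx 0 i + p) = (h / sqrt2)%:C%C * w + zc p) ->
  derivable (fun z : C^o => alpha z (uc p) : C^o) (zc p) 1 ->
  is_derive p (delta_mx 0 i) (fun q => phi (alpha (zc q) (uc q)))
    (phi (w * derive1 (fun z : C^o => alpha z (uc p) : C^o) (zc p)) / sqrt2).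
Proof.
move=> phi_le phiB phiZ w1 i2 zsh fd.
have s20 := sqrt2_gt0.
set c := derive1 _ _.
have lim : (fun h : R => h^-1 *: (((fun q => phi (alpha (zc q) (uc q))) \o shift p)
     (h *: delta_mx 0 i) - phi (alpha (zc p) (uc p)))) @ 0^' --> phi (w * c) / sqrt2.
  apply/cvgrPdist_lt => e e0.
  have [d d0 dP] := derivable_complex fd e0.
  near=> h.
  have h0 : h != 0 by near: h; exact: nbhs_dnbhs_neq.
  have hd : `|h| < d.
    near: h; apply: dnbhs0_lt => //.
  set k := (h / sqrt2)%:C%C * w.
  have w0 : w != 0 by apply/eqP => w0; move/eqP: w1; rewrite w0 Normc.normc0 eq_sym oner_eq0.
  have hs0 : (h / sqrt2)%:C%C != 0 :> C.
    by rewrite (_ : 0 = 0%:C%C) // (inj_eq (@complexI R)) mulf_neq0 // invr_neq0 // gt_eqF.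
  have k0 : k != 0 by rewrite mulf_neq0.
  have kd : normc k < d.
    rewrite Normc.normcM w1 mulr1 /= expr0n addr0 sqrtr_sqr.
    exact: le_lt_trans (normr_div_sqrt2 _) hd.
  have := dP k k0 kd; rewrite -/c /= => H.
  rewrite /GRing.scale /= uc_shift // zsh -/k.
  set Q := k^-1 * _ in H.
  have -> : h^-1 * (phi (alpha (k + zc p) (uc p)) - phi (alpha (zc p) (uc p)))
     = sqrt2^-1 * phi (w * Q).
    rewrite -phiB -!phiZ; congr phi.
    have -> : (h^-1)%:C%C = (sqrt2^-1)%:C%C * ((h / sqrt2)%:C%C)^-1 :> C.
      by rewrite -fmorphV -rmorphM /=; congr (_%:C%C); field; rewrite h0 gt_eqF.
    rewrite /Q /k; move: ((h / sqrt2)%:C%C : C) ((sqrt2^-1)%:C%C : C) (_ - _ : C) hs0 => m n D m0.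
    by field; rewrite m0 w0.
  rewrite mulrC -mulrBr -phiB -mulrBr normrM ger0_norm ?invr_ge0 ?ltW //.
  apply: (@le_lt_trans _ _ (normc (w * (c - Q)))).
    apply: le_trans (phi_le _).
    by rewrite ler_piMl // invf_le1 ?sqrt2_ge1.
  by rewrite Normc.normcM w1 mul1r.
apply: DeriveDef; first by apply/cvg_ex; eexists; exact: lim.
exact: cvg_lim.
Unshelve. all: by end_near. Qed.

End HolomorphicProfile.

(** * Cauchy-Riemann equations imply complex differentiability *)

Section SecondDerivative.
Context {R : realType}.
Local Notation C := R[i].
Local Notation E := 'rV[R]_4.
Local Notation normc := (@Normc.normc R).
Local Notation sqrt2 := (Num.sqrt 2 : R).

(** Allows steps of either sign in [MVT_slice], at the price of locating the
    intermediate point only in the ball. *)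
Lemma MVT_ball (p q : E) (d t : R) (i : 'I_4) (f : E -> R) :
  smooth (ball p d) f -> ball p d q -> ball p d (q + t *: delta_mx 0 i) ->
  exists2 r, ball p d r & f (q + t *: delta_mx 0 i) - f q = t * partial i f r.
Proof.
move=> fs bq bqt.
have pos q' t' : 0 < t' -> ball p d q' -> ball p d (q' + t' *: delta_mx 0 i) ->
    exists2 r, ball p d r & f (q' + t' *: delta_mx 0 i) - f q' = t' * partial i f r.
  move=> t0 bq' bqt'.
  have bs s : 0 <= s <= t' -> ball p d (q' + s *: delta_mx 0 i) by exact: ball_slice.
  have [s st|c ct ->] := @MVT_slice R 4 f i q' t' t0.
    exact: @ex_derive _ _ _ _ _ _ _ (smooth_isd i fs (bs s st)).
  by exists (q' + c *: delta_mx 0 i); [exact: bs|rewrite mulrC].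
have [t0|t0|->] := ltgtP t 0; last by exists q => //; rewrite scale0r addr0 subrr mul0r.
  have tN : 0 < - t by rewrite oppr_gt0.
  have qE : q + t *: delta_mx 0 i + (- t) *: delta_mx 0 i = q.
    by rewrite scaleNr addrK.
  have [|r br] := pos _ _ tN bqt; first by rewrite qE.
  rewrite qE => e; exists r => //.
  by apply: oppr_inj; rewrite opprB e mulNr.
exact: pos.
Qed.

Lemma ball_plane (p : E) (d s t : R) : `|s| < d -> `|t| < d ->
  ball p d (p + s *: delta_mx 0 i_x1) /\
  ball p d (p + s *: delta_mx 0 i_x1 + t *: delta_mx 0 i_x2).
Proof.
move=> sd td; have d0 : 0 < d := le_lt_trans (normr_ge0 _) sd.
split; split => // k j; rewrite -ball_normE /= (ord1 k) !mxE eqxx /=;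
  elim/ord4_ind: j => /=; rewrite ?(mulr0, mulr1, addr0) ?subrr ?normr0 //;
  by rewrite opprD addrA subrr add0r normrN.
Qed.

(** Total differentiability in (x1, x2): the increment is split into two
    coordinate steps, each controlled by the continuity of a partial
    derivative. *)
Lemma smooth_differentiable (M : set E) (F : E -> R) p e : open M -> smooth M F ->
  M p -> 0 < e -> exists2 d, 0 < d & forall s t, `|s| < d -> `|t| < d ->
    M (p + s *: delta_mx 0 i_x1 + t *: delta_mx 0 i_x2) /\
    `|F (p + s *: delta_mx 0 i_x1 + t *: delta_mx 0 i_x2) - F p
      - s * partial i_x1 F p - t * partial i_x2 F p| <= e * (`|s| + `|t|).
Proof.
move=> oM Fs Mp e0.
have nb i : nbhs p [set q | `|partial i F p - partial i F q| < e].
  by have /cvgrPdist_lt /(_ _ e0) := smooth_cont (smooth_partial i Fs) Mp.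
have : nbhs p (M `&` ([set q | `|partial i_x1 F p - partial i_x1 F q| < e] `&`
   [set q | `|partial i_x2 F p - partial i_x2 F q| < e])).
  by apply: filterI; [exact: open_nbhs_nbhs|exact: filterI].
move=> /nbhs_ballP[d /= d0 dU]; exists d => // s t sd td.
have [b1 b2] := ball_plane p sd td.
have Fb : smooth (ball p d) F by apply: smooth_sub Fs => q /dU[].
split; first by case: (dU _ b2).
have [r1 br1 E1] := MVT_ball Fb b1 b2.
have [r0 br0 E0] := MVT_ball Fb (ballxx p d0) b1.
have -> : F (p + s *: delta_mx 0 i_x1 + t *: delta_mx 0 i_x2) - F p
      - s * partial i_x1 F p - t * partial i_x2 F p =
    s * (partial i_x1 F r0 - partial i_x1 F p) + t * (partial i_x2 F r1 - partial i_x2 F p).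
  by rewrite !mulrBr -E0 -E1; ring.
have [_ [h0 _]] := dU _ br0; have [_ [_ h1]] := dU _ br1.
apply: le_trans (ler_normD _ _) _; rewrite !normrM mulrDr.
by apply: lerD; rewrite mulrC ler_wpM2r // distrC ltW.
Qed.

(** By the Cauchy-Riemann equations the real differential at p is the
    multiplication by a complex number.  Only the values of f near z enter,
    hence f is compared with (F, G) inside M only. *)
Lemma derive1_CR (M : set E) (F G : E -> R) (p : E) (f : C^o -> C^o) :
  open M -> smooth M F -> smooth M G -> M p ->
  partial i_x2 F p = - partial i_x1 G p -> partial i_x2 G p = partial i_x1 F p ->
  (forall s t, let q := p + s *: delta_mx 0 i_x1 + t *: delta_mx 0 i_x2 in
     M q -> f (zc q) = Complex (F q) (G q)) ->
  derive1 f (zc p) = Complex (sqrt2 * partial i_x1 F p) (sqrt2 * partial i_x1 G p).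
Proof.
move=> oM Fs Gs Mp CR1 CR2 fE; apply: derive1_complex => e e0.
have s20 := @sqrt2_gt0 R; have s21 := @sqrt2_ge1 R; have s2s := @sqrt2_sqr R.
(* The two errors add up to at most (e / 16) times 8 |k|, that is e |k| / 2. *)
have e16 : 0 < e / 16 by rewrite divr_gt0.
have [d1 d10 H1] := smooth_differentiable oM Fs Mp e16.
have [d2 d20 H2] := smooth_differentiable oM Gs Mp e16.
pose d := Num.min d1 d2.
have d0 : 0 < d by rewrite lt_min d10.
exists (d / 2); first by rewrite divr_gt0.
move=> k k0 kd.
pose s := sqrt2 * complex.Re k; pose t := sqrt2 * complex.Im k.
have nk : 0 <= normc k by apply: le_trans (Re_le_normc k).
have nk0 : 0 < normc k.
  by rewrite lt_neqAle nk andbT eq_sym; apply: contra k0 => /eqP/Normc.eq0_normc ->.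
have s22 : sqrt2 <= 2 by rewrite -[leRHS]s2s ler_peMl // ltW.
have bnd x : `|x| <= normc k -> `|sqrt2 * x| <= 2 * normc k.
  move=> xk; rewrite normrM (ger0_norm (ltW s20)).
  by apply: ler_pM => //; exact: ltW.
have sk : `|s| <= 2 * normc k by apply: bnd; exact: Re_le_normc.
have tk : `|t| <= 2 * normc k by apply: bnd; exact: Im_le_normc.
have kd' : 2 * normc k < d by rewrite mulrC -ltr_pdivlMr.
have sd := le_lt_trans sk kd'; have td := le_lt_trans tk kd'.
move: (sd) (td); rewrite !lt_min => /andP[s1 s2'] /andP[t1 t2'].
have [Mq h1] := H1 s t s1 t1; have [_ h2] := H2 s t s2' t2'.
set q := p + s *: delta_mx 0 i_x1 + t *: delta_mx 0 i_x2 in Mq h1 h2.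
have zq : k + zc p = zc q.
  rewrite !zcE; apply/eqP; rewrite eq_complex /q !mxE /= /s /t; case: k {k0 kd nk nk0 s t bnd sk tk kd' sd td s1 s2' t1 t2' q Mq h1 h2} => a b /=.
  by apply/andP; split; apply/eqP; field; rewrite gt_eqF.
have fp : f (zc p) = Complex (F p) (G p).
  by have := fE 0 0; rewrite /= !scale0r !addr0; apply.
rewrite zq (fE s t Mq) fp -/q.
set D : C := Complex (F q) (G q) - _; set l : C := Complex (sqrt2 * _) _.
have -> : l - k^-1 * D = k^-1 * (k * l - D) by rewrite [RHS]mulrBr mulKf.
rewrite Normc.normcM Normc.normcV mulrC ltr_pdivrMr //.
apply: le_lt_trans (normc_le_add _) _.
have -> : complex.Re (k * l - D) = - (F q - F p - s * partial i_x1 F p - t * partial i_x2 F p).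
  rewrite CR1 /D /l /s /t; case: (k) => a b /=; ring.
have -> : complex.Im (k * l - D) = - (G q - G p - s * partial i_x1 G p - t * partial i_x2 G p).
  rewrite CR2 /D /l /s /t; case: (k) => a b /=; ring.
rewrite !normrN; apply: le_lt_trans (lerD h1 h2) _.
have e160 := ltW e16.
rewrite -mulrDr; apply: le_lt_trans (ler_wpM2l e160 (lerD (lerD sk tk) (lerD sk tk))) _.
have en : 0 < e * normc k by rewrite mulr_gt0.
have -> : e / 16 * (2 * normc k + 2 * normc k + (2 * normc k + 2 * normc k))
  = e * normc k / 2 by field.
by rewrite ltr_pdivrMr // ltr_pMr // ltr1n.
Qed.

End SecondDerivative.

(** * Jets of the profile *)

Section ProfileJets.
Context {R : realType}.
Local Notation C := R[i].
Local Notation E := 'rV[R]_4.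
Local Notation sqrt2 := (Num.sqrt 2 : R).

Variables (Omega : set (C * R)) (alpha : C -> R -> C).
Hypotheses (Omega_open : open (Omega : set (C^o * R)))
    (alpha_smooth : smooth_alpha Omega alpha)
    (alpha_hol : holomorphic_in_z Omega alpha).

Local Notation M := (chart Omega).
Let A (q : E) := complex.Re (alpha (zc q) (uc q)).
Let B (q : E) := complex.Im (alpha (zc q) (uc q)).
Local Notation H := (profile alpha).

Let oM : open M. Proof. exact: chart_open. Qed.
Let As : smooth M A. Proof. exact: alpha_smooth.1. Qed.
Let Bs : smooth M B. Proof. exact: alpha_smooth.2. Qed.

Lemma alpha_partials p : M p ->
  let c := derive1 (fun z : C^o => alpha z (uc p) : C^o) (zc p) in
  [/\ partial i_x1 A p = complex.Re c / sqrt2, partial i_x1 B p = complex.Im c / sqrt2,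
      partial i_x2 A p = - complex.Im c / sqrt2 & partial i_x2 B p = complex.Re c / sqrt2].
Proof.
move=> Mp c; have fd := alpha_hol Mp.
have w1 : Normc.normc (1 : C) = 1 by rewrite Normc.normc1.
have wi : Normc.normc ('i%C : C) = 1 by rewrite /= expr0n expr1n add0r sqrtr1.
have ReB z z' : complex.Re (z - z' : C) = complex.Re z - complex.Re z' by case: z; case: z'.
have ImB z z' : complex.Im (z - z' : C) = complex.Im z - complex.Im z' by case: z; case: z'.
have ReZ x z : complex.Re (x%:C%C * z : C) = x * complex.Re z by case: z => a b /=; ring.
have ImZ x z : complex.Im (x%:C%C * z : C) = x * complex.Im z by case: z => a b /=; ring.
have n0 : i_x1 != i_u by []. have n1 : i_x2 != i_u by [].
have D0A := holomorphic_partial (@Re_le_normc R) ReB ReZ w1 n0 (zc_shift0 p) fd.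
have D0B := holomorphic_partial (@Im_le_normc R) ImB ImZ w1 n0 (zc_shift0 p) fd.
have D1A := holomorphic_partial (@Re_le_normc R) ReB ReZ wi n1 (zc_shift1 p) fd.
have D1B := holomorphic_partial (@Im_le_normc R) ImB ImZ wi n1 (zc_shift1 p) fd.
rewrite (partialP D0A) (partialP D0B) (partialP D1A) (partialP D1B) -/c mul1r.
by rewrite (mulrC 'i%C c) ReiNIm ImiRe.
Qed.

Lemma CR_A p : M p -> partial i_x2 A p = - partial i_x1 B p.
Proof. by move=> /alpha_partials[_ -> -> _]; rewrite mulNr. Qed.

Lemma CR_B p : M p -> partial i_x2 B p = partial i_x1 A p.
Proof. by move=> /alpha_partials[-> _ _ ->]. Qed.

Lemma dz_alpha p : M p -> derive1 (fun z : C^o => alpha z (uc p) : C^o) (zc p)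
  = Complex (sqrt2 * partial i_x1 A p) (sqrt2 * partial i_x1 B p).
Proof.
move=> /alpha_partials[-> -> _ _]; set c := derive1 _ _.
have s0 : sqrt2 != 0 by rewrite gt_eqF ?sqrt2_gt0.
by rewrite !mulrA !(mulrC sqrt2) !mulfK //; case: (c : C).
Qed.

(** Commute the derivatives, then differentiate the Cauchy-Riemann equation
    along x1. *)
Lemma CR_A0 p : M p -> partial i_x2 (partial i_x1 A) p = - partial i_x1 (partial i_x1 B) p.
Proof.
move=> Mp; rewrite (partial_comm _ _ oM As Mp).
exact: (partialP_on oM Mp CR_A (isd_opp (smooth_isd i_x1 (smooth_partial i_x1 Bs) Mp))).
Qed.

Lemma CR_B0 p : M p -> partial i_x2 (partial i_x1 B) p = partial i_x1 (partial i_x1 A) p.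
Proof.
move=> Mp; rewrite (partial_comm _ _ oM Bs Mp).
exact: (partialP_on oM Mp CR_B (smooth_isd i_x1 (smooth_partial i_x1 As) Mp)).
Qed.

(** Since d/dz is sqrt 2 d/dx1 on holomorphic functions. *)
Lemma dz2_alpha p : M p -> dz2 alpha (zc p) (uc p)
  = Complex (2 * partial i_x1 (partial i_x1 A) p) (2 * partial i_x1 (partial i_x1 B) p).
Proof.
move=> Mp; rewrite /dz2 /derive1n /=.
have sc f : smooth M f -> smooth M (fun q => sqrt2 * f q).
  by move=> fs; apply: smooth_mul => //; exact: smooth_cst.
have pZ i f : smooth M f -> partial i (fun q => sqrt2 * f q) p = sqrt2 * partial i f p.
  move=> fs; apply: partialP.
  by apply: (is_derive_eq (isd_mul (isd_cst _ _ sqrt2) (smooth_isd i fs Mp))); rewrite mul0r add0r.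
have A0s := smooth_partial i_x1 As; have B0s := smooth_partial i_x1 Bs.
rewrite (derive1_CR oM (sc _ A0s) (sc _ B0s) Mp).
- by rewrite !pZ // !mulrA sqrt2_sqr.
- by rewrite !pZ // CR_A0 // mulrN.
- by rewrite !pZ // CR_B0.
move=> s t q Mq; have uq : uc q = uc p by rewrite /q !ucE !mxE /= !mulr0 !addr0.
by have := dz_alpha Mq; rewrite uq => ->.
Qed.

Lemma profileE q : H q = sqrt2 * (q 0 i_x1 * A q + q 0 i_x2 * B q).
Proof.
rewrite /profile /A /B zcE; case: (alpha _ _) => a b.
have -> : (Complex (q 0 i_x1 / sqrt2) (q 0 i_x2 / sqrt2))^* = Complex (q 0 i_x1 / sqrt2) (- (q 0 i_x2 / sqrt2)) by [].
have -> : (Complex a b)^* = Complex a (- b) by [].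
have s0 : sqrt2 != 0 by rewrite gt_eqF ?sqrt2_gt0.
move: (@sqrt2_sqr R) s0; move: (sqrt2) => s ss s0 /=.
have -> : s * (q 0 i_x1 * a + q 0 i_x2 * b) = 2 * (q 0 i_x1 * a + q 0 i_x2 * b) / s.
  by rewrite -ss; field.
by field.
Qed.

Lemma profile_smooth : smooth M H.
Proof.
apply: (@smooth_ext _ _ _ (fun q => sqrt2 * (q 0 i_x1 * A q + q 0 i_x2 * B q))) => //.
  by move=> q _; rewrite profileE.
apply: smooth_mul => //; first exact: smooth_cst.
by apply: smooth_add => //; apply: smooth_mul => //; exact: smooth_coord.
Qed.

Lemma profile_isd i p a b : is_derive p (delta_mx 0 i) A a ->
  is_derive p (delta_mx 0 i) B b ->
  partial i H p = sqrt2 * ((i == i_x1)%:R * A p + p 0 i_x1 * a + ((i == i_x2)%:R * B p + p 0 i_x2 * b)).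
Proof.
move=> Aa Bb; have -> : H = fun q => sqrt2 * (q 0 i_x1 * A q + q 0 i_x2 * B q).
  by apply/funext => q; exact: profileE.
apply: partialP.
apply: (is_derive_eq (isd_mul (isd_cst _ _ sqrt2)
  (isd_add (isd_mul (isd_coord _ _ _) Aa) (isd_mul (isd_coord _ _ _) Bb)))).
by rewrite mul0r add0r.
Qed.

Lemma profile_r p : partial i_r H p = 0.
Proof.
(* The difference quotient along r vanishes identically. *)
have c (F : C -> R -> R) : is_derive p (delta_mx 0 i_r) (fun q => F (zc q) (uc q)) 0.
  have E0 : (fun h : R => h^-1 *: (((fun q => F (zc q) (uc q)) \o shift p) (h *: delta_mx 0 i_r)
      - F (zc p) (uc p))) = fun=> 0.
    apply/funext => h /=; rewrite uc_shift // (_ : zc (_ + p) = zc p) ?subrr ?scaler0 //.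
    by rewrite !zcE !mxE /= !mulr0 !add0r.
  apply: DeriveDef.
    by rewrite /derivable E0; exact: is_cvg_cst.
  by rewrite /derive E0; exact: lim_cst.
rewrite (profile_isd (c (fun z u => complex.Re (alpha z u))) (c (fun z u => complex.Im (alpha z u)))).
by rewrite /= !mulr0 !mul0r !addr0 mulr0.
Qed.

Lemma partial_x1_profile p : M p -> partial i_x1 H p
  = sqrt2 * (A p + (p 0 i_x1 * partial i_x1 A p + p 0 i_x2 * partial i_x1 B p)).
Proof.
move=> Mp; rewrite (profile_isd (smooth_isd i_x1 As Mp) (smooth_isd i_x1 Bs Mp)) /=.
by rewrite mul1r mul0r add0r addrA.
Qed.

Lemma partial_x2_profile p : M p -> partial i_x2 H p
  = sqrt2 * (B p + (p 0 i_x2 * partial i_x1 A p - p 0 i_x1 * partial i_x1 B p)).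
Proof.
move=> Mp; rewrite (profile_isd (smooth_isd i_x2 As Mp) (smooth_isd i_x2 Bs Mp)) /=.
rewrite CR_A // CR_B //; move: (partial i_x1 A p) (partial i_x1 B p) => a b; ring.
Qed.

Let A00 p := partial i_x1 (partial i_x1 A) p.
Let B00 p := partial i_x1 (partial i_x1 B) p.

(** The Cauchy-Riemann equations express all second derivatives of H by
    derivatives along x1. *)
Lemma profile_jets p : M p ->
  [/\ partial i_x1 (partial i_x1 H) p = sqrt2 * (2 * partial i_x1 A p + p 0 i_x1 * A00 p + p 0 i_x2 * B00 p),
      partial i_x2 (partial i_x2 H) p = sqrt2 * (2 * partial i_x1 A p - p 0 i_x1 * A00 p - p 0 i_x2 * B00 p) &
      partial i_x1 (partial i_x2 H) p = sqrt2 * (p 0 i_x2 * A00 p - p 0 i_x1 * B00 p)].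
Proof.
move=> Mp.
have dA i := smooth_isd i As Mp; have dB i := smooth_isd i Bs Mp.
have dA0 i := smooth_isd i (smooth_partial i_x1 As) Mp.
have dB0 i := smooth_isd i (smooth_partial i_x1 Bs) Mp.
have d1 i := isd_mul (isd_cst p (delta_mx 0 i) sqrt2) (isd_add (dB i)
  (isd_add (isd_mul (isd_coord i i_x2 p) (dA0 i)) (isd_opp (isd_mul (isd_coord i i_x1 p) (dB0 i))))).
have d0 i := isd_mul (isd_cst p (delta_mx 0 i) sqrt2) (isd_add (dA i)
  (isd_add (isd_mul (isd_coord i i_x1 p) (dA0 i)) (isd_mul (isd_coord i i_x2 p) (dB0 i)))).
rewrite (partialP_on oM Mp partial_x1_profile (d0 i_x1)) (partialP_on oM Mp partial_x2_profile (d1 i_x2)).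
rewrite (partialP_on oM Mp partial_x2_profile (d1 i_x1)) CR_B // CR_A0 // CR_B0 //= -/(A00 p) -/(B00 p).
by move: (partial i_x1 A p) (partial i_x1 B p) (A00 p) (B00 p) (sqrt2) => a b a0 b0 s; split; ring.
Qed.

Lemma laplacian_profile p : M p -> laplacian H p = 4 * sqrt2 * partial i_x1 A p.
Proof.
by move=> Mp; rewrite /laplacian; have [-> -> _] := profile_jets Mp; ring.
Qed.

Lemma partial_laplacian p : M p -> partial i_x1 (laplacian H) p = 4 * sqrt2 * A00 p /\
  partial i_x2 (laplacian H) p = - (4 * sqrt2 * B00 p).
Proof.
move=> Mp.
have d i := isd_mul (isd_cst p (delta_mx 0 i) (4 * sqrt2)) (smooth_isd i (smooth_partial i_x1 As) Mp).
rewrite !(partialP_on oM Mp laplacian_profile (d _)) CR_A0 //.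
by rewrite !mul0r !add0r mulrN.
Qed.

(** Real part of conj(z) (L / 2)_z = H_zz, up to a constant factor. *)
Lemma profile_pde_re p : M p ->
  p 0 i_x1 * partial i_x1 (laplacian H) p - p 0 i_x2 * partial i_x2 (laplacian H) p
    = 2 * (partial i_x1 (partial i_x1 H) p - partial i_x2 (partial i_x2 H) p).
Proof.
move=> Mp; have [-> ->] := partial_laplacian Mp; have [-> -> _] := profile_jets Mp; ring.
Qed.

(** Imaginary part of conj(z) (L / 2)_z = H_zz, up to a constant factor. *)
Lemma profile_pde_im p : M p ->
  p 0 i_x1 * partial i_x2 (laplacian H) p + p 0 i_x2 * partial i_x1 (laplacian H) p
    = 4 * partial i_x1 (partial i_x2 H) p.
Proof.
move=> Mp; have [-> ->] := partial_laplacian Mp; have [_ _ ->] := profile_jets Mp; ring.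
Qed.

Lemma dz2_eq0 p : M p -> dz2 alpha (zc p) (uc p) = 0 <->
  partial i_x1 (laplacian H) p = 0 /\ partial i_x2 (laplacian H) p = 0.
Proof.
move=> Mp; rewrite dz2_alpha // -/(A00 p) -/(B00 p); have [-> ->] := partial_laplacian Mp.
have s0 : 4 * sqrt2 != 0 by rewrite mulf_neq0 // gt_eqF ?sqrt2_gt0.
have n2 : (2 : R) != 0 by [].
split=> [[a b]|[a /eqP b]].
  have -> : A00 p = 0 by apply: (mulfI n2); rewrite a mulr0.
  have -> : B00 p = 0 by apply: (mulfI n2); rewrite b mulr0.
  by rewrite !mulr0 oppr0.
have -> : A00 p = 0 by apply: (mulfI s0); rewrite a mulr0.
have -> : B00 p = 0.
  by apply: (mulfI s0); rewrite mulr0; apply/eqP; rewrite -oppr_eq0.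
by rewrite !mulr0.
Qed.

Lemma g4E : g4 alpha = brinkmann H.
Proof.
have c0 : (0 : 'I_4) = i_x1 by exact: val_inj.
have c1 : (1 : 'I_4) = i_x2 by exact: val_inj.
have c2 : (2 : 'I_4) = i_u by exact: val_inj.
have c3 : (3 : 'I_4) = i_r by exact: val_inj.
apply/funext => p; apply/matrixP; rewrite /brinkmann /g4 /symprod /dcoord c3 c2 c1 c0.
move: (H p) => h.
by elim/ord4_ind; elim/ord4_ind; rewrite !mxE !big_ord1 !mxE /=; field.
Qed.

Lemma chart_point (z : C) (u : R) : exists p : E, zc p = z /\ uc p = u.
Proof.
exists (\row_(j < 4) match val j with
  | 0%N => sqrt2 * complex.Re z | 1%N => sqrt2 * complex.Im z | _ => u end).
rewrite zcE ucE !mxE /=; split => //.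
have s0 : sqrt2 != 0 by rewrite gt_eqF ?sqrt2_gt0.
by rewrite !(mulrC sqrt2) !mulfK //; case: z.
Qed.

Lemma flat_einstein (V : set E) (g : E -> 'M[R]_4) : flat_on g V -> einstein_on g V.
Proof.
move=> fl; exists 0 => p Vp i j; rewrite mul0r /ricci big1 // => k _; exact: fl.
Qed.

Lemma einstein_dz2 : conformally_einstein M (g4 alpha) ->
  forall z u, Omega (z, u) -> dz2 alpha z u = 0.
Proof.
move=> ein z u Ozu; have [p [zp up]] := chart_point z u.
have Mp : M p by rewrite /chart /= zp up.
have [V [oV Vp VM [Y [Ys eV]]]] := ein p Mp.
rewrite -zp -up; apply/(dz2_eq0 Mp); rewrite g4E in eV.
apply: (@einstein_rigidity R V H Y) => //.
- exact: smooth_sub VM profile_smooth.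
- by move=> q _; exact: profile_r.
- by move=> q /VM; exact: profile_pde_re.
- by move=> q /VM; exact: profile_pde_im.
Qed.

Lemma dz2_flat : (forall z u, Omega (z, u) -> dz2 alpha z u = 0) ->
  conformally_flat M (g4 alpha).
Proof.
move=> dz0; rewrite g4E.
have D0 p : M p -> partial i_x1 (laplacian H) p = 0 /\ partial i_x2 (laplacian H) p = 0.
  by move=> Mp; apply/(dz2_eq0 Mp); exact: dz0.
apply: locally_flat => //.
- exact: profile_smooth.
- by move=> p _; exact: profile_r.
- move=> p Mp; have := profile_pde_re Mp; have [-> ->] := D0 p Mp.
  by rewrite !mulr0 subrr => /esym/eqP; rewrite mulf_eq0 pnatr_eq0 /= subr_eq0 => /eqP.
- move=> p Mp; have := profile_pde_im Mp; have [-> ->] := D0 p Mp.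
  by rewrite !mulr0 addr0 => /esym/eqP; rewrite mulf_eq0 pnatr_eq0 /= => /eqP.
Qed.

Lemma cotton_flat_z_neq0 : conformally_on cotton_flat_on (chart_z_neq0 Omega) (g4 alpha).
Proof.
pose t (q : E) := q 0 i_x1 * q 0 i_x1 + q 0 i_x2 * q 0 i_x2.
have ts : smooth M t.
  by apply: smooth_add => //; apply: smooth_mul => //; apply: smooth_coord.
have tE q : (t q != 0) = (zc q != 0).
  have s0 : sqrt2 != 0 by rewrite gt_eqF ?sqrt2_gt0.
  rewrite zcE eq_complex /= !mulf_eq0 invr_eq0 (negbTE s0) !orbF.
  by rewrite /t -!expr2 paddr_eq0 ?sqr_ge0 // !sqrf_eq0.
have -> : chart_z_neq0 Omega = M `&` [set q | t q != 0].
  apply/seteqP; split=> q [Mq]; first by move=> /eqP zq; split=> //=; rewrite tE.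
  by rewrite /= tE => /eqP.
have oV := open_smooth_neq0 oM ts; set V := M `&` _ in oV *.
have VM : V `<=` M by move=> q [].
have t0 q : V q -> 0 < t q.
  by move=> [_ tq]; rewrite lt_neqAle eq_sym tq addr_ge0 // -expr2 sqr_ge0.
exists (@radial_scale R); rewrite g4E; split; first exact: radial_smooth.
apply: cotton_radial_rescaling => //.
- exact: smooth_sub VM profile_smooth.
- by move=> q _; exact: profile_r.
- by move=> q /VM; exact: profile_pde_re.
- by move=> q /VM; exact: profile_pde_im.
Qed.

End ProfileJets.

Theorem theorem3 (R : realType) (Omega : set (R[i] * R))
    (alpha : R[i] -> R -> R[i])
    (Omega_open : open (Omega : set (R[i]^o * R)))
    (alpha_smooth : smooth_alpha Omega alpha)
    (alpha_hol : holomorphic_in_z Omega alpha) :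
  let M := chart Omega in
  let g := g4 alpha in
  [/\ conformally_on cotton_flat_on (chart_z_neq0 Omega) g,
      ((forall z u, Omega (z, u) -> dz2 alpha z u = 0)
         <-> conformally_flat M g),
      (conformally_flat M g <-> conformally_einstein M g)
    & ((exists z u, Omega (z, u) /\ dz2 alpha z u <> 0)
         -> ~ conformally_einstein M g)].
Proof.
move=> M g.
have flat_ein : conformally_flat M g -> conformally_einstein M g.
  move=> fl p /fl[V [oV Vp VM [Y [Ys fY]]]].
  by exists V; split => //; exists Y; split => //; exact: flat_einstein.
have ein_dz2 := einstein_dz2 Omega_open alpha_smooth alpha_hol.
have dz2_fl := dz2_flat Omega_open alpha_smooth alpha_hol.
split.
- exact: cotton_flat_z_neq0.
- by split=> [/dz2_fl|/flat_ein/ein_dz2].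
- by split=> [/flat_ein|/ein_dz2/dz2_fl].
- by move=> [z [u [Ozu nz]]] /ein_dz2/(_ z u Ozu).
Qed.
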